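(* Let $M>0$ and $\alpha\in(0,1]$, and let $f=h+\overline{g}\in\mathcal{P}_{\mathcal{H}}^0(\alpha,M)$ with $h(z)=z+\sum_{n=2}^\infty a_nz^n$ and $g(z)=\sum_{n=2}^\infty b_nz^n$ for $z\in\mathbb{D}$. Then for every $z\in\mathbb{D}$, $$|z|+2(M-\alpha+1)\sum_{n=2}^{\infty}\frac{(-1)^{n-1}|z|^{n}}{n(1+\alpha (n-2))}\leq |f(z)|\leq |z|+2(M-\alpha+1)\sum_{n=2}^{\infty}\frac{|z|^n}{n(1+\alpha (n-2))}.$$ Moreover, for each $z\in\mathbb{D}$ with $z\neq 0$, equality occurs (in each of the two inequalities) for the function $f_0(z)=z+2(M-\alpha+1)\sum_{n=2}^{\infty}\frac{z^n}{n(1+\alpha (n-2))}$ or for a suitable rotation of it.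
   Context: $\mathbb{D}=\{z\in\mathbb{C}:|z|<1\}$. $\mathcal{H}$ is the class of complex-valued harmonic functions $f=h+\overline{g}$ in $\mathbb{D}$, with $h,g$ analytic in $\mathbb{D}$ and $h(0)=h'(0)-1=0$, $g(0)=0$. For $M>0$ and $\alpha\in(0,1]$, $\mathcal{P}_{\mathcal{H}}^0(\alpha,M)$ is the class of all $f=h+\overline{g}\in\mathcal{H}$ with $g'(0)=0$ and $$\mathrm{Re}\left((1-\alpha)h'(z)+\alpha zh''(z)\right)>-M+\left|(1-\alpha)g'(z)+\alpha zg''(z)\right|\quad\text{for all } z\in\mathbb{D}.$$ A rotation of $f_0$ is a function of the form $z\mapsto e^{-i\theta}f_0(e^{i\theta}z)$ with $\theta\in\mathbb{R}$; the rotation attaining equality may depend on $z$ and on which of the two inequalities is considered.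
   Formalization: Equality in the lower inequality is claimed only when the lower bound at |z| is nonnegative; otherwise (e.g. alpha=1, M=3, |z|=1/2) the bound is negative and no modulus can equal it. *)

(* Defs.v *)
From Stdlib Require Import Reals.
From Coquelicot Require Import Coquelicot.
Local Open Scope R_scope.

Definition in_disk (z : C) : Prop := Cmod z < 1.

(* Complex differentiability at every point of the open disk (the derivative is
   taken over the field C, not over R). *)
Definition analytic_on_disk (f : C -> C) : Prop :=
  forall z : C, in_disk z ->
    ex_derive (K := C_AbsRing) (V := C_NormedModule) f z.

Definition harmonic_map (h g : C -> C) (z : C) : C := (h z + Cconj (g z))%C.

(* The map [harmonic_map h g] belongs to the class H with analytic part h and
   co-analytic part g; the normalization [g 0 = 0] makes (h, g) unique, so a
   member of H is represented by this pair. *)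
Definition class_H (h g : C -> C) : Prop :=
  analytic_on_disk h /\ analytic_on_disk g /\
  h (RtoC 0) = RtoC 0 /\ C_derive h (RtoC 0) = RtoC 1 /\ g (RtoC 0) = RtoC 0.

(* [C_derive] is total, but on the disk it is the genuine derivative, since the
   derivatives of a function analytic on the disk are again analytic there. *)
Definition alpha_operator (alpha : R) (u : C -> C) (z : C) : C :=
  (RtoC (1 - alpha) * C_derive u z
   + RtoC alpha * z * C_derive (C_derive u) z)%C.

Definition class_P0H (alpha M : R) (h g : C -> C) : Prop :=
  class_H h g /\ C_derive g (RtoC 0) = RtoC 0 /\
  forall z : C, in_disk z ->
    Re (alpha_operator alpha h z) > - M + Cmod (alpha_operator alpha g z).

(* Sum of a complex series: componentwise, as in Coquelicot's [C_lim]. *)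
Definition C_Series (u : nat -> C) : C :=
  (Series (fun n => Re (u n)), Series (fun n => Im (u n))).

Lemma C_Series_unique (u : nat -> C) (l : C) :
  is_series (K := C_AbsRing) (V := C_NormedModule) u l -> C_Series u = l.
Proof.
  intros H.
  assert (Hsum : forall n,
    sum_n (G := C_AbelianMonoid) u n =
    (sum_n (fun k => Re (u k)) n, sum_n (fun k => Im (u k)) n)).
  { intros n; induction n as [|n IH].
    - rewrite !sum_O. apply surjective_pairing.
    - rewrite !sum_Sn, IH. reflexivity. }
  assert (HR : is_series (fun k => Re (u k)) (Re l)).
  { intros P [e HP]. unfold filtermap.
    assert (HC : locally (T := C_UniformSpace) l (ball (M := C_UniformSpace) l e))
      by (exists e; auto).
    destruct (H _ HC) as [N HN].
    exists N; intros n Hn. apply HP.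
    specialize (HN n Hn). simpl in HN. rewrite Hsum in HN. apply HN. }
  assert (HI : is_series (fun k => Im (u k)) (Im l)).
  { intros P [e HP]. unfold filtermap.
    assert (HC : locally (T := C_UniformSpace) l (ball (M := C_UniformSpace) l e))
      by (exists e; auto).
    destruct (H _ HC) as [N HN].
    exists N; intros n Hn. apply HP.
    specialize (HN n Hn). simpl in HN. rewrite Hsum in HN. apply HN. }
  unfold C_Series.
  rewrite (is_series_unique _ _ HR), (is_series_unique _ _ HI).
  symmetry; apply surjective_pairing.
Qed.

(* n (1 + alpha (n - 2)), meant for n >= 2. *)
Definition coef_den (alpha : R) (n : nat) : R :=
  INR n * (1 + alpha * (INR n - 2)).

(* Sums over n >= 2 are indexed by k = n - 2 >= 0. *)
Definition upper_bound (alpha M r : R) : R :=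
  r + 2 * (M - alpha + 1) *
      Series (fun k => r ^ (k + 2) / coef_den alpha (k + 2)).

(* This is negative for some r when M is large (e.g. alpha = 1, M = 3, r = 1/2), in
   which case no modulus can equal it. *)
Definition lower_bound (alpha M r : R) : R :=
  r + 2 * (M - alpha + 1) *
      Series (fun k => (-1) ^ (k + 2 - 1) * r ^ (k + 2) / coef_den alpha (k + 2)).

Definition extremal_map (alpha M : R) (z : C) : C :=
  (z + RtoC (2 * (M - alpha + 1)) *
       C_Series (fun k => z ^ (k + 2) / RtoC (coef_den alpha (k + 2))))%C.

(* exp (i theta) *)
Definition cis (theta : R) : C := (cos theta, sin theta).

Definition rotation (theta : R) (f : C -> C) (z : C) : C :=
  (cis (- theta) * f (cis theta * z))%C.

(* Main.v *)
Require Import Defs.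
From Stdlib Require Import Reals Lra Lia.
From Coquelicot Require Import Coquelicot.
Local Open Scope R_scope.

(** At a fixed point [z] choose [eps] of modulus 1 with [Cconj (g z) = eps * g z]; then
    [harmonic_map h g z = F z] for the analytic function [F = h + eps g], and the
    hypothesis gives [Re p > - M] for [p = (1 - alpha) F' + alpha z F'']. If
    [p = 1 - alpha + sum d_k z^k], then [F z / z = 1 + sum lambda_k d_k z^k] with
    [lambda_k = 1 / ((k + 1) (1 + alpha (k - 1)))].

    Both bounds follow from a positivity pairing. If two absolutely convergent cosine
    series are nonnegative, with coefficients [X_k] and [T_k], then
    [2 X_0 T_0 + sum_(k >= 1) X_k T_k >= 0], by orthogonality of the cosines. Taking
    for [X] the even part of [Re p + M] on a circle, and [T = 1 - cos (k t)], yields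
    [|d_k| <= 2 (M - alpha + 1)], hence the upper bound. The lower bound comes from
    [T = sum_(k >= 1) lambda_k s^k (cos (k t) - (-1)^k)]. For [lambda = 1] this
    is nonnegative by the closed form of the Poisson kernel, and dividing the coefficients
    by [beta k + gamma] preserves nonnegativity on [[0, 1)], because
    [beta s y' + gamma y >= 0] and [y 0 = 0] force [y >= 0]. *)

(** * Complex power series on the unit disk *)

(* Coquelicot states series equations in the carrier of a module, where [ring]
   does not recognize [R] or [C]. *)
Ltac eq_as T := match goal with |- @eq _ ?x ?y => change (@eq T x y) end.

Notation is_Cseries :=
  (is_series (K := C_AbsRing) (V := C_NormedModule)).

Definition is_Cpseries (c : nat -> C) (z l : C) : Prop :=
  is_Cseries (fun n => c n * z ^ n)%C l.

Lemma sum_n_C (u : nat -> C) (n : nat) :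
  sum_n (G := C_AbelianMonoid) u n =
  (sum_n (fun k => Re (u k)) n, sum_n (fun k => Im (u k)) n).
Proof.
  induction n as [|n IH].
  - rewrite !sum_O. apply surjective_pairing.
  - rewrite !sum_Sn, IH. reflexivity.
Qed.

Lemma is_Cseries_Re (u : nat -> C) (l : C) :
  is_Cseries u l -> is_series (fun n => Re (u n)) (Re l).
Proof.
  intros H P [e HP]. unfold filtermap.
  assert (HC : locally (T := C_UniformSpace) l (ball (M := C_UniformSpace) l e))
    by (exists e; auto).
  destruct (H _ HC) as [N HN].
  exists N; intros n Hn. apply HP.
  specialize (HN n Hn). simpl in HN. rewrite sum_n_C in HN. apply HN.
Qed.

Lemma is_Cseries_Im (u : nat -> C) (l : C) :
  is_Cseries u l -> is_series (fun n => Im (u n)) (Im l).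
Proof.
  intros H P [e HP]. unfold filtermap.
  assert (HC : locally (T := C_UniformSpace) l (ball (M := C_UniformSpace) l e))
    by (exists e; auto).
  destruct (H _ HC) as [N HN].
  exists N; intros n Hn. apply HP.
  specialize (HN n Hn). simpl in HN. rewrite sum_n_C in HN. apply HN.
Qed.

Lemma is_Cseries_pair (u : nat -> C) (l : C) :
  is_series (fun n => Re (u n)) (Re l) ->
  is_series (fun n => Im (u n)) (Im l) -> is_Cseries u l.
Proof.
  intros HR HI P [e HP]. unfold filtermap.
  destruct (HR (ball (Re l) e)) as [N1 H1]; [now exists e|].
  destruct (HI (ball (Im l) e)) as [N2 H2]; [now exists e|].
  exists (max N1 N2); intros n Hn. apply HP.
  simpl. rewrite sum_n_C. split; simpl; [apply H1 | apply H2]; lia.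
Qed.

(** The sum may change along with the terms, so one algebraic identity for each turns a known series
    into the desired one. *)
Lemma is_Cseries_ext (u v : nat -> C) (l l' : C) :
  (forall n, u n = v n) -> l = l' -> is_Cseries u l -> is_Cseries v l'.
Proof. intros E <- H. exact (is_series_ext (V := C_NormedModule) u v l E H). Qed.

Lemma is_Cseries_plus (u v : nat -> C) (l m : C) :
  is_Cseries u l -> is_Cseries v m -> is_Cseries (fun n => u n + v n)%C (l + m)%C.
Proof. exact (is_series_plus (V := C_NormedModule) u v l m). Qed.

Lemma is_Cseries_scal (k : C) (u : nat -> C) (l : C) :
  is_Cseries u l -> is_Cseries (fun n => k * u n)%C (k * l)%C.
Proof. exact (is_series_scal (V := C_NormedModule) k u l). Qed.

Lemma is_Cseries_decr (u : nat -> C) (l : C) :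
  is_Cseries (fun n => u (S n)) l -> is_Cseries u (l + u 0%nat)%C.
Proof.
  intros H. apply (is_series_decr_1 (V := C_NormedModule)).
  revert H. apply is_Cseries_ext; [easy|].
  change (l = (l + u 0%nat + - u 0%nat)%C). ring.
Qed.

Lemma is_Cseries_incr (u : nat -> C) (l : C) :
  is_Cseries u l -> is_Cseries (fun n => u (S n)) (l - u 0%nat)%C.
Proof.
  intros H. apply (is_series_incr_1 (V := C_NormedModule)).
  revert H. apply is_Cseries_ext; [easy|].
  change (l = (l - u 0%nat + u 0%nat)%C). ring.
Qed.

Lemma is_Cseries_unique (u : nat -> C) (l m : C) :
  is_Cseries u l -> is_Cseries u m -> l = m.
Proof.
  intros Hl Hm. now rewrite <- (C_Series_unique u l Hl), (C_Series_unique u m Hm).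
Qed.

Lemma Cmod_le_Re_Im (z : C) : Cmod z <= Rabs (Re z) + Rabs (Im z).
Proof.
  assert (H1 := Rabs_pos (Re z)). assert (H2 := Rabs_pos (Im z)).
  apply Rsqr_incr_0_var; [|lra]. unfold Rsqr.
  replace (Cmod z * Cmod z) with (Cmod z ^ 2) by ring.
  rewrite Cmod2_alt, <- (pow2_abs (Re z)), <- (pow2_abs (Im z)). nra.
Qed.

Lemma Rabs_Im_le_Cmod (z : C) : Rabs (Im z) <= Cmod z.
Proof. eapply Rle_trans; [apply Rmax_r | apply Rmax_Cmod]. Qed.

Lemma ex_Cseries_Cmod (u : nat -> C) :
  ex_series (fun n => Cmod (u n)) -> exists l, is_Cseries u l.
Proof.
  intros H.
  destruct (ex_series_le (fun n => Re (u n)) (fun n => Cmod (u n))) as [lr Hr];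
    [intros n; apply re_le_Cmod | exact H |].
  destruct (ex_series_le (fun n => Im (u n)) (fun n => Cmod (u n))) as [li Hi];
    [intros n; apply Rabs_Im_le_Cmod | exact H |].
  exists (lr, li). now apply is_Cseries_pair.
Qed.

Lemma Cmod_Cseries_le (u : nat -> C) (v : nat -> R) (l : C) (s : R) :
  is_Cseries u l -> (forall n, Cmod (u n) <= v n) -> is_series v s -> Cmod l <= s.
Proof.
  intros Hu Huv Hv.
  destruct (Req_dec (Cmod l) 0) as [E|E].
  - rewrite E.
    apply (is_lim_seq_le (fun _ => 0) (sum_n v) 0 s);
      [|apply is_lim_seq_const|exact Hv].
    intros n. rewrite <- (Rmult_0_r (INR (S n))), <- sum_n_const.
    apply sum_n_m_le. intros k. eapply Rle_trans; [apply Cmod_ge_0|apply Huv].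
  - assert (Hp := Cmod_ge_0 l).
    (* Rotating [l] onto the positive axis reduces the claim to real parts. *)
    set (w := (Cconj l / RtoC (Cmod l))%C).
    assert (Hl0 : RtoC (Cmod l) <> RtoC 0) by (intros K; apply E; now injection K).
    assert (Hw : Cmod w = 1).
    { unfold w. rewrite Cmod_div, Cmod_conj, Cmod_R, Rabs_pos_eq; trivial. now field. }
    assert (Hwl : (w * l)%C = RtoC (Cmod l)).
    { unfold w. replace (Cconj l / RtoC (Cmod l) * l)%C
        with (l * Cconj l / RtoC (Cmod l))%C by now field.
      rewrite <- Cmod2_conj, RtoC_pow. now field. }
    assert (H := is_Cseries_Re _ _ (is_Cseries_scal w u l Hu)).
    rewrite Hwl in H. change (Re (RtoC (Cmod l))) with (Cmod l) in H.
    apply (is_lim_seq_le (sum_n (fun n => Re (w * u n)%C)) (sum_n v) (Cmod l) s);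
      [|exact H|exact Hv].
    intros n. apply sum_n_m_le. intros k.
    eapply Rle_trans; [apply Rle_abs|]. eapply Rle_trans; [apply re_le_Cmod|].
    rewrite Cmod_mult, Hw, Rmult_1_l. apply Huv.
Qed.

(** Bounded terms at the midpoint of [r] and 1 put the radius at or above that midpoint, which makes
    the inequality strict at [r]. *)
Lemma CV_radius_ge_1 (a : nat -> R) :
  (forall r, 0 <= r < 1 -> exists B, forall n, Rabs (a n * r ^ n) <= B) ->
  forall r, 0 <= r < 1 -> Rbar_lt r (CV_radius a).
Proof.
  intros H r Hr. apply Rbar_lt_le_trans with ((r + 1) / 2).
  - simpl; lra.
  - destruct (CV_radius_bounded a) as [Hub _]. apply Hub. apply H. lra.
Qed.

Lemma is_lim_seq_bounded (u : nat -> R) (l : R) :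
  is_lim_seq u l -> exists B, forall n, Rabs (u n) <= B.
Proof.
  intros H.
  destruct (filterlim_bounded u) as [B HB]; [now exists l|].
  exists B. exact HB.
Qed.

Definition converges_on_disk (c : nat -> C) : Prop :=
  forall z, in_disk z -> exists l, is_Cpseries c z l.

(** Convergence at real points suffices: the terms there tend to 0 and so are bounded. From here on,
    real power series theory applies to the moduli of the coefficients. *)
Lemma Rlt_CV_radius_Cmod (c : nat -> C) :
  converges_on_disk c ->
  forall r, 0 <= r < 1 -> Rbar_lt r (CV_radius (fun n => Cmod (c n))).
Proof.
  intros Hc. apply CV_radius_ge_1. intros r Hr.
  destruct (Hc (RtoC r)) as [l Hl].
  { unfold in_disk. rewrite Cmod_R, Rabs_pos_eq; lra. }
  assert (H1 := ex_series_lim_0 _ (ex_intro _ _ (is_Cseries_Re _ _ Hl))).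
  assert (H2 := ex_series_lim_0 _ (ex_intro _ _ (is_Cseries_Im _ _ Hl))).
  apply is_lim_seq_bounded in H1. apply is_lim_seq_bounded in H2.
  destruct H1 as [B1 H1], H2 as [B2 H2].
  exists (B1 + B2). intros n.
  replace (Cmod (c n) * r ^ n) with (Cmod (c n * RtoC r ^ n)%C).
  2:{ now rewrite Cmod_mult, Cmod_pow, Cmod_R, (Rabs_pos_eq r) by lra. }
  rewrite Rabs_pos_eq by apply Cmod_ge_0.
  eapply Rle_trans; [apply Cmod_le_Re_Im|].
  specialize (H1 n); specialize (H2 n). cbv beta in H1, H2. lra.
Qed.

Lemma ex_series_Cmod_pow (c : nat -> C) (r : R) :
  converges_on_disk c -> 0 <= r < 1 -> ex_series (fun n => Cmod (c n) * r ^ n).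
Proof.
  intros Hc Hr.
  eapply ex_series_ext;
    [|apply (CV_disk_inside (fun n => Cmod (c n)) r)].
  - intros n. simpl. apply Rabs_pos_eq.
    apply Rmult_le_pos; [apply Cmod_ge_0|apply pow_le; lra].
  - rewrite (Rabs_pos_eq r) by lra. now apply Rlt_CV_radius_Cmod.
Qed.

Lemma converges_on_disk_bound (c : nat -> C) (a : nat -> R) :
  (forall n, Cmod (c n) <= a n) ->
  (forall r, 0 <= r < 1 -> Rbar_lt r (CV_radius a)) -> converges_on_disk c.
Proof.
  intros Hca Ha z Hz. apply ex_Cseries_Cmod.
  assert (Hz0 := Cmod_ge_0 z).
  apply (ex_series_le (V := R_CompleteNormedModule) _ (fun n => Rabs (a n * Cmod z ^ n))).
  - intros n. change (Rabs (Cmod (c n * z ^ n)) <= Rabs (a n * Cmod z ^ n)).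
    rewrite Rabs_pos_eq by apply Cmod_ge_0.
    rewrite Cmod_mult, Cmod_pow.
    eapply Rle_trans; [|apply Rle_abs].
    apply Rmult_le_compat_r; [now apply pow_le|apply Hca].
  - apply CV_disk_inside. rewrite (Rabs_pos_eq (Cmod z)) by easy. now apply Ha.
Qed.

(** * Termwise differentiation of complex power series *)

Definition Cderive_coef (c : nat -> C) (n : nat) : C := (RtoC (INR (S n)) * c (S n))%C.

Lemma Cmod_Cderive_coef (c : nat -> C) (n : nat) :
  Cmod (Cderive_coef c n) = PS_derive (fun k => Cmod (c k)) n.
Proof.
  unfold Cderive_coef, PS_derive. rewrite Cmod_mult, Cmod_R, Rabs_pos_eq; trivial.
  apply pos_INR.
Qed.

Lemma converges_on_disk_derive (c : nat -> C) :
  converges_on_disk c -> converges_on_disk (Cderive_coef c).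
Proof.
  intros Hc.
  apply converges_on_disk_bound with (PS_derive (fun k => Cmod (c k))).
  - intros n. rewrite Cmod_Cderive_coef. apply Rle_refl.
  - intros r Hr. rewrite CV_radius_derive. now apply Rlt_CV_radius_Cmod.
Qed.

(** The constant is twice the sharp one; in this form the bounds sum to the second derivative of the
    series of moduli. *)
Lemma pow_taylor_remainder (y z : C) (r : R) (n : nat) :
  Cmod y <= r -> Cmod z <= r ->
  Cmod (y ^ (S (S n)) - z ^ (S (S n)) - (y - z) * (RtoC (INR (S (S n))) * z ^ (S n)))%C
    <= INR (S n) * INR (S (S n)) * r ^ n * Cmod (y - z) ^ 2.
Proof.
  intros Hy Hz.
  assert (Hr : 0 <= r) by (eapply Rle_trans; [apply Cmod_ge_0|exact Hy]).
  assert (Hd := Cmod_ge_0 (y - z)).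
  induction n as [|n IH].
  - replace (y ^ 2 - z ^ 2 - (y - z) * (RtoC (INR 2) * z ^ 1))%C with ((y - z) ^ 2)%C.
    + rewrite Cmod_pow. simpl. nra.
    + simpl INR. rewrite RtoC_plus. simpl. ring.
  (* The remainders satisfy [R_(m+1) = y R_m + m (y - z)^2 z^(m-1)], here with [m = n + 2]. *)
  - replace (y ^ S (S (S n)) - z ^ S (S (S n)) - (y - z) * (RtoC (INR (S (S (S n)))) * z ^ S (S n)))%C
      with (y * (y ^ (S (S n)) - z ^ (S (S n)) - (y - z) * (RtoC (INR (S (S n))) * z ^ (S n)))
            + RtoC (INR (S (S n))) * (y - z) ^ 2 * z ^ (S n))%C.
    2:{ rewrite (S_INR (S (S n))), RtoC_plus. simpl Cpow. ring. }
    eapply Rle_trans; [apply Cmod_triangle|].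
    rewrite !Cmod_mult, !Cmod_pow, Cmod_R, (Rabs_pos_eq (INR _)) by apply pos_INR.
    set (E := Cmod (_ - _ - _)%C) in *. set (d := Cmod (y - z)) in *.
    assert (HE : 0 <= E) by apply Cmod_ge_0.
    assert (H1 : Cmod y * E <= r * (INR (S n) * INR (S (S n)) * r ^ n * d ^ 2)).
    { apply Rmult_le_compat; trivial. apply Cmod_ge_0. }
    assert (H2 : Cmod z ^ S n <= r ^ S n) by (apply pow_incr; split; [apply Cmod_ge_0|easy]).
    assert (H3 : INR (S (S n)) * d ^ 2 * Cmod z ^ S n <= INR (S (S n)) * d ^ 2 * r ^ S n).
    { apply Rmult_le_compat_l; trivial.
      apply Rmult_le_pos; [apply pos_INR|apply pow_le; easy]. }
    eapply Rle_trans; [apply Rplus_le_compat; [exact H1|exact H3]|].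
    replace (r ^ S n) with (r * r ^ n) by reflexivity.
    assert (H4 : 0 <= r * r ^ n * d ^ 2).
    { apply Rmult_le_pos; [apply Rmult_le_pos|]; trivial; now apply pow_le. }
    rewrite !S_INR. set (N := INR n). assert (HN : 0 <= N) by apply pos_INR.
    set (X := r * r ^ n * d ^ 2) in *.
    replace (r * ((N + 1) * (N + 1 + 1) * r ^ n * d ^ 2) + (N + 1 + 1) * d ^ 2 * (r * r ^ n))
      with ((N + 1 + 1) * (N + 2) * X) by (unfold X; ring).
    replace ((N + 1 + 1) * (N + 1 + 1 + 1) * (r * r ^ n) * d ^ 2)
      with ((N + 1 + 1) * (N + 1 + 1 + 1) * X) by (unfold X; ring).
    apply Rmult_le_compat_r; trivial. nra.
Qed.

(** Summing the Taylor remainders of the powers bounds the remainder of [f] by a constant times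
    [|y - z|^2], and this is little-o of [|y - z|]. *)
Lemma is_derive_Cpseries (c : nat -> C) (f : C -> C) (z l : C) :
  (forall w, in_disk w -> is_Cpseries c w (f w)) -> in_disk z ->
  is_Cpseries (Cderive_coef c) z l ->
  is_derive (K := C_AbsRing) (V := C_NormedModule) f z l.
Proof.
  intros Hf Hz Hl.
  assert (Hc : converges_on_disk c) by (intros w Hw; exists (f w); auto).
  set (r := (1 + Cmod z) / 2).
  assert (Hz0 := Cmod_ge_0 z). unfold in_disk in Hz.
  assert (Hr : 0 <= r < 1) by (unfold r; lra).
  (* [r] lies midway between [|z|] and 1, so the second derivative of the series of moduli converges
     at [r] and bounds the quadratic remainder near [z]. *)
  set (B := PSeries (PS_derive (PS_derive (fun k => Cmod (c k)))) r).
  assert (HB : is_series (fun n => INR (S n) * INR (S (S n)) * Cmod (c (S (S n))) * r ^ n) B).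
  { assert (H : ex_pseries (PS_derive (PS_derive (fun k => Cmod (c k)))) r).
    { apply CV_radius_inside. rewrite !CV_radius_derive, Rabs_pos_eq by lra.
      now apply Rlt_CV_radius_Cmod. }
    apply PSeries_correct in H. fold B in H. apply is_pseries_R in H.
    revert H. apply is_series_ext. intros n. unfold PS_derive. eq_as R. ring. }
  assert (HB0 : 0 <= B).
  { apply (is_lim_seq_le (fun _ => 0)
      (sum_n (fun n => INR (S n) * INR (S (S n)) * Cmod (c (S (S n))) * r ^ n)) 0 B);
      [|apply is_lim_seq_const|exact HB].
    intros n. rewrite <- (Rmult_0_r (INR (S n))), <- sum_n_const.
    apply sum_n_m_le. intros k.
    repeat apply Rmult_le_pos; try apply pos_INR; try apply Cmod_ge_0. now apply pow_le. }
  assert (Hrem : forall y, Cmod y <= r ->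
    Cmod (f y - f z - (y - z) * l)%C <= B * Cmod (y - z) ^ 2).
  { intros y Hy.
    (* The constant terms of [f y - f z] cancel, and the linear terms cancel against the head of
       [(y - z) l]. Each cancellation drops one index, which leaves the remainders of the powers
       from 2 on. *)
    assert (S1 := Hf y ltac:(unfold in_disk; lra)).
    assert (S2 := Hf z ltac:(unfold in_disk; lra)).
    apply (is_Cseries_scal (- RtoC 1)%C) in S2.
    assert (S3 := is_Cseries_plus _ _ _ _ S1 S2).
    apply is_Cseries_incr in S3.
    apply (is_Cseries_scal (- (y - z))%C) in Hl.
    assert (S4 := is_Cseries_plus _ _ _ _ S3 Hl).
    apply is_Cseries_incr in S4.
    assert (S5 : is_series (fun n => INR (S n) * INR (S (S n)) * Cmod (c (S (S n))) * r ^ n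
                              * Cmod (y - z) ^ 2) (B * Cmod (y - z) ^ 2)).
    { apply (is_series_scal_r (Cmod (y - z) ^ 2)) in HB. exact HB. }
    refine (Cmod_Cseries_le _ _ _ _ _ _ S5).
    2:{ intros n. rewrite (Rmult_comm (_ * _) (Cmod (c (S (S n))))).
        rewrite !Rmult_assoc.
        refine (Rle_trans _ _ _ _ (Rmult_le_compat_l _ _ _ (Cmod_ge_0 _) _)).
        2:{ rewrite <- !Rmult_assoc. apply (pow_taylor_remainder y z r n); [easy|unfold r; lra]. }
        rewrite <- Cmod_mult. apply Rle_refl. }
    revert S4. apply is_Cseries_ext.
    - intros n. unfold Cderive_coef. ring.
    - unfold Cderive_coef. simpl. ring. }
  split.
  { apply (is_linear_scal_l (K := C_AbsRing) (V := C_NormedModule)). }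
  intros x Hx.
  apply (is_filter_lim_locally_unique (K := C_AbsRing) (V := AbsRing_NormedModule C_AbsRing)) in Hx.
  subst x. intros eps.
  (* The first bound keeps [|y| <= r], the second gives [B |y - z| <= eps]; [B + 1] avoids a
     division by 0. *)
  set (d := Rmin (r - Cmod z) (eps / (B + 1))).
  assert (Hd : 0 < d).
  { apply Rmin_pos; [unfold r; lra|]. apply Rdiv_lt_0_compat; [apply cond_pos|lra]. }
  exists (mkposreal d Hd). intros y Hy.
  change (Cmod (y - z) < d) in Hy.
  change (Cmod (f y - f z - (y - z) * l)%C <= eps * Cmod (y - z)).
  assert (Hd1 := Rmin_l (r - Cmod z) (eps / (B + 1))).
  assert (Hd2 := Rmin_r (r - Cmod z) (eps / (B + 1))). fold d in Hd1, Hd2.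
  eapply Rle_trans; [apply Hrem|].
  - replace y with (z + (y - z))%C by ring.
    eapply Rle_trans; [apply Cmod_triangle|]. lra.
  - simpl. rewrite Rmult_1_r, <- Rmult_assoc.
    apply Rmult_le_compat_r; [apply Cmod_ge_0|].
    assert (H : Cmod (y - z) <= eps / (B + 1)) by lra.
    apply Rle_trans with (B * (eps / (B + 1))); [now apply Rmult_le_compat_l|].
    apply Rmult_le_reg_r with (B + 1); [lra|].
    assert (He := cond_pos eps).
    replace (B * (eps / (B + 1)) * (B + 1)) with (B * eps) by (field; lra).
    nra.
Qed.

(** The conclusion has the shape of the hypothesis, with [C_derive f] for [f], so the lemma can be
    iterated for second derivatives. *)
Lemma C_derive_Cpseries (c : nat -> C) (f : C -> C) :
  (forall w, in_disk w -> is_Cpseries c w (f w)) -> forall z, in_disk z ->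
  is_derive (K := C_AbsRing) (V := C_NormedModule) f z (C_derive f z) /\
  is_Cpseries (Cderive_coef c) z (C_derive f z).
Proof.
  intros Hf z Hz.
  assert (Hc : converges_on_disk c) by (intros w Hw; exists (f w); auto).
  destruct (converges_on_disk_derive c Hc z Hz) as [l Hl].
  assert (H := is_derive_Cpseries c f z l Hf Hz Hl).
  now rewrite (is_C_derive_unique f z l H).
Qed.

Lemma is_Cpseries_at_0 (c : nat -> C) (l : C) : is_Cpseries c (RtoC 0) l -> l = c 0%nat.
Proof.
  intros H. apply is_Cseries_incr in H.
  (* All tail terms vanish at 0, so scaling the tail by 0 leaves its terms unchanged and shows that
     its sum is 0. *)
  assert (H0 : is_Cseries (fun n => c (S n) * RtoC 0 ^ S n)%C (RtoC 0 * RtoC 0)%C).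
  { assert (H1 := is_Cseries_scal (RtoC 0) _ _ H).
    revert H1. apply is_Cseries_ext; [intros n; simpl|]; ring. }
  assert (E := is_Cseries_unique _ _ _ H H0). simpl in E.
  replace l with (l - c 0%nat * RtoC 1 + c 0%nat)%C by ring. rewrite E. ring.
Qed.

(** The coefficient comes from [(1 - alpha) (n + 1) + alpha (n + 1) n = (n + 1) (1 + alpha (n -
    1))]. *)
Lemma alpha_operator_Cpseries (alpha : R) (c : nat -> C) (f : C -> C) :
  (forall w, in_disk w -> is_Cpseries c w (f w)) -> forall z, in_disk z ->
  is_Cpseries (fun n => RtoC (coef_den alpha (S n)) * c (S n))%C z (alpha_operator alpha f z).
Proof.
  intros Hf z Hz.
  assert (H1 := fun w Hw => proj2 (C_derive_Cpseries c f Hf w Hw)).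
  assert (H2 := proj2 (C_derive_Cpseries _ _ H1 z Hz)).
  specialize (H1 z Hz).
  apply (is_Cseries_scal (RtoC (1 - alpha))) in H1.
  apply (is_Cseries_scal (RtoC alpha * z)%C) in H2.
  (* Multiplying [f''] by [z] shifts its powers by one; a vanishing term at index 0 aligns them with
     those of [f']. *)
  assert (H3 : is_Cseries (fun n => RtoC (alpha * INR n) * Cderive_coef c n * z ^ n)%C
                 (RtoC alpha * z * C_derive (C_derive f) z + RtoC 0)%C).
  { assert (E : (RtoC 0 = RtoC (alpha * INR 0) * Cderive_coef c 0 * z ^ 0)%C).
    { simpl INR. rewrite Rmult_0_r. ring. }
    rewrite E.
    apply (is_Cseries_decr (fun n => RtoC (alpha * INR n) * Cderive_coef c n * z ^ n)%C).
    revert H2. apply is_Cseries_ext; [|easy].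
    intros n. unfold Cderive_coef. rewrite RtoC_mult. simpl Cpow. ring. }
  assert (H4 := is_Cseries_plus _ _ _ _ H1 H3).
  revert H4. apply is_Cseries_ext.
  - intros n. unfold Cderive_coef, coef_den. rewrite S_INR.
    rewrite !RtoC_mult, !RtoC_plus, RtoC_mult, !RtoC_minus, RtoC_plus.
    ring.
  - unfold alpha_operator. ring.
Qed.

(** * Pairing of nonnegative cosine series *)

Lemma sin_2PI_nat (n : nat) : sin (INR n * (2 * PI)) = 0.
Proof.
  replace (INR n * (2 * PI)) with (0 + 2 * INR n * PI) by ring.
  rewrite sin_period. apply sin_0.
Qed.

Lemma is_RInt_cos_nat (n : nat) :
  is_RInt (fun t => cos (INR n * t)) 0 (2 * PI) (if (n =? 0)%nat then 2 * PI else 0).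
Proof.
  destruct n as [|n].
  - change (if (0 =? 0)%nat then 2 * PI else 0) with (2 * PI).
    apply is_RInt_ext with (fun _ => 1).
    + intros t _. simpl INR. now rewrite Rmult_0_l, cos_0.
    + assert (H := is_RInt_const (V := R_NormedModule) 0 (2 * PI) 1).
      change (is_RInt (fun _ => 1) 0 (2 * PI) ((2 * PI - 0) * 1)) in H.
      now rewrite Rminus_0_r, Rmult_1_r in H.
  - change (if (S n =? 0)%nat then 2 * PI else 0) with 0.
    assert (Hn : INR (S n) <> 0) by (apply not_0_INR; lia).
    assert (Hs := sin_2PI_nat (S n)). revert Hn Hs. generalize (INR (S n)). intros a Hn Hs.
    assert (H : is_RInt (fun t => cos (a * t)) 0 (2 * PI)
                  (sin (a * (2 * PI)) / a - sin (a * 0) / a)).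
    { apply (is_RInt_derive (fun t => sin (a * t) / a)
                            (fun t => cos (a * t))).
      - intros t _. auto_derive; [easy|]. now field.
      - intros t _. apply (ex_derive_continuous (fun t => cos (a * t))).
        auto_derive. easy. }
    rewrite Hs, Rmult_0_r, sin_0, Rminus_diag in H. exact H.
Qed.

(** The integral of [cos (n t)^2] over a period. The doubled value at 0 is why [X_0 T_0] counts
    twice in the pairing. *)
Definition cos_weight (n : nat) : R := if (n =? 0)%nat then 2 * PI else PI.

Lemma is_RInt_eq (f g : R -> R) (a b l l' : R) :
  (forall t, f t = g t) -> l = l' -> is_RInt f a b l -> is_RInt g a b l'.
Proof. intros E <-. apply is_RInt_ext. intros t _. apply E. Qed.

Lemma is_RInt_Rplus (f g : R -> R) (a b lf lg : R) :
  is_RInt f a b lf -> is_RInt g a b lg -> is_RInt (fun t => f t + g t) a b (lf + lg).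
Proof. exact (is_RInt_plus f g a b lf lg). Qed.

Lemma is_RInt_Rscal (k : R) (f : R -> R) (a b l : R) :
  is_RInt f a b l -> is_RInt (fun t => k * f t) a b (k * l).
Proof. exact (is_RInt_scal f a b k l). Qed.

Lemma is_RInt_cos_mult (n k : nat) :
  is_RInt (fun t => cos (INR n * t) * cos (INR k * t)) 0 (2 * PI)
    (if (n =? k)%nat then cos_weight n else 0).
Proof.
  (* Writing the larger index as [i + j] makes the difference frequency the natural number [j]; the
     other order follows by symmetry. *)
  assert (main : forall i j : nat,
    is_RInt (fun t => cos (INR (i + j) * t) * cos (INR i * t)) 0 (2 * PI)
      (if (j =? 0)%nat then cos_weight i else 0)).
  { intros i j.
    assert (H := is_RInt_Rscal (/ 2) _ _ _ _
                   (is_RInt_Rplus _ _ _ _ _ _ (is_RInt_cos_nat (i + j + i)) (is_RInt_cos_nat j))).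
    revert H. apply is_RInt_eq.
    - intros t.
      replace (INR (i + j + i) * t) with (INR (i + j) * t + INR i * t)
        by (rewrite !plus_INR; ring).
      replace (INR j * t) with (INR (i + j) * t - INR i * t) by (rewrite !plus_INR; ring).
      rewrite cos_plus, cos_minus. field.
    - unfold cos_weight.
      destruct (Nat.eqb_spec (i + j + i) 0), (Nat.eqb_spec j 0), (Nat.eqb_spec i 0);
        try lia; lra. }
  destruct (Nat.le_gt_cases k n) as [L|L].
  - specialize (main k (n - k)%nat). replace (k + (n - k))%nat with n in main by lia.
    destruct (Nat.eqb_spec (n - k) 0), (Nat.eqb_spec n k); try lia; trivial.
    now subst.
  - specialize (main n (k - n)%nat). replace (n + (k - n))%nat with k in main by lia.
    revert main. apply is_RInt_eq.
    + intros t. apply Rmult_comm.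
    + destruct (Nat.eqb_spec (k - n) 0), (Nat.eqb_spec n k); try lia; trivial.
Qed.

Lemma is_RInt_cos_poly_mult (X : nat -> R) (N k : nat) :
  is_RInt (fun t => sum_n (fun n => X n * cos (INR n * t)) N * cos (INR k * t)) 0 (2 * PI)
    (if (k <=? N)%nat then X k * cos_weight k else 0).
Proof.
  assert (step := fun n => is_RInt_Rscal (X n) _ _ _ _ (is_RInt_cos_mult n k)).
  cbv beta in step. induction N as [|N IH].
  - generalize (step 0%nat). apply is_RInt_eq.
    + intros t. rewrite sum_O. ring.
    + destruct (Nat.leb_spec k 0), (Nat.eqb_spec 0 k); try lia; subst; trivial; ring.
  - generalize (is_RInt_Rplus _ _ _ _ _ _ IH (step (S N))). apply is_RInt_eq.
    + intros t. rewrite sum_Sn. change (@plus _ ?a ?b) with (a + b). ring.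
    + destruct (Nat.leb_spec k N), (Nat.leb_spec k (S N)), (Nat.eqb_spec (S N) k);
        try lia; subst; ring.
Qed.

(** The product of the two polynomials has a nonnegative integral over a period, and by
    orthogonality that integral is [PI] times the claimed quantity. *)
Lemma cos_poly_pairing_nonneg (X T : nat -> R) (N : nat) :
  (forall t, 0 <= sum_n (fun n => X n * cos (INR n * t)) N) ->
  (forall t, 0 <= sum_n (fun n => T n * cos (INR n * t)) N) ->
  0 <= X 0%nat * T 0%nat + sum_n (fun n => X n * T n) N.
Proof.
  intros HX HT.
  assert (step : forall k, (k <= N)%nat ->
    is_RInt (fun t => T k * (sum_n (fun n => X n * cos (INR n * t)) N * cos (INR k * t)))
      0 (2 * PI) (T k * (X k * cos_weight k))).
  { intros k Hk. assert (H := is_RInt_cos_poly_mult X N k).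
    destruct (Nat.leb_spec k N); [|lia]. now apply is_RInt_Rscal. }
  (* Only the second factor is truncated in the induction: each new [cos (k t)] is paired with the
     whole first polynomial and picks out [X k], since [k <= N]. *)
  assert (main : forall K, (K <= N)%nat ->
    is_RInt (fun t => sum_n (fun n => X n * cos (INR n * t)) N
                      * sum_n (fun n => T n * cos (INR n * t)) K) 0 (2 * PI)
      (PI * (X 0%nat * T 0%nat + sum_n (fun n => X n * T n) K))).
  { intros K. induction K as [|K IH]; intros HK.
    - generalize (step 0%nat HK). apply is_RInt_eq.
      + intros t. rewrite sum_O. ring.
      + rewrite sum_O. unfold cos_weight. simpl Nat.eqb. cbv iota. ring.
    - generalize (is_RInt_Rplus _ _ _ _ _ _ (IH ltac:(lia)) (step (S K) HK)). apply is_RInt_eq.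
      + intros t. rewrite (sum_Sn _ K). change (@plus _ ?a ?b) with (a + b). ring.
      + rewrite (sum_Sn _ K). change (@plus _ ?a ?b) with (a + b).
        unfold cos_weight. simpl Nat.eqb. cbv iota. ring. }
  assert (Hpi := PI_RGT_0).
  assert (H := is_RInt_ge_0 _ 0 (2 * PI) _ ltac:(lra) (main N (Nat.le_refl N))
                 (fun t _ => Rmult_le_pos _ _ (HX t) (HT t))).
  apply Rmult_le_reg_l with PI; [easy|]. rewrite Rmult_0_r. exact H.
Qed.

Lemma ex_series_cos (X : nat -> R) (t : R) :
  ex_series (fun n => Rabs (X n)) -> ex_series (fun n => X n * cos (INR n * t)).
Proof.
  apply (ex_series_le (V := R_CompleteNormedModule)). intros n.
  change (Rabs (X n * cos (INR n * t)) <= Rabs (X n)). rewrite Rabs_mult.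
  rewrite <- (Rmult_1_r (Rabs (X n))) at 2.
  apply Rmult_le_compat_l; [apply Rabs_pos|]. apply Rabs_le, COS_bound.
Qed.

(** Raising the constant coefficient raises the cosine sum by [d] at every [t]. *)
Definition add_head (d : R) (X : nat -> R) (n : nat) : R :=
  match n with O => X 0%nat + d | _ => X n end.

Lemma sum_n_add_head_mult (d : R) (X Y : nat -> R) (N : nat) :
  sum_n (fun n => add_head d X n * Y n) N = d * Y 0%nat + sum_n (fun n => X n * Y n) N.
Proof.
  induction N as [|N IH].
  - rewrite !sum_O. simpl. eq_as R. ring.
  - rewrite !sum_Sn, IH. simpl add_head. eq_as R. change (@plus _ ?a ?b) with (a + b). ring.
Qed.

(** Truncating at [N] changes the cosine series by at most the tail of the absolute values; adding
    that tail to the constant term restores nonnegativity. *)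
Lemma cos_sum_add_tail_nonneg (X : nat -> R) (N : nat) (t : R) :
  ex_series (fun n => Rabs (X n)) ->
  0 <= Series (fun n => X n * cos (INR n * t)) ->
  0 <= sum_n (fun n => add_head (Series (fun k => Rabs (X k)) - sum_n (fun k => Rabs (X k)) N) X n
                       * cos (INR n * t)) N.
Proof.
  intros HX H0. rewrite sum_n_add_head_mult.
  simpl INR. rewrite Rmult_0_l, cos_0, Rmult_1_r.
  assert (H1 := Series_correct _ HX).
  assert (H2 := Series_correct _ (ex_series_cos X t HX)).
  set (S := Series (fun n => Rabs (X n))) in *.
  set (U := Series (fun n => X n * cos (INR n * t))) in *.
  assert (H3 : is_lim_seq (fun n => sum_n (fun k => Rabs (X k)) n
                                  - sum_n (fun k => X k * cos (INR k * t)) n) (S - U)).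
  { apply (is_lim_seq_minus' _ _ _ _ H1 H2). }
  (* The partial sums of [|X_k| - X_k cos (k t)] increase, so each is at most the limit. *)
  assert (H4 := is_lim_seq_incr_compare _ _ H3).
  assert (H5 : sum_n (fun k => Rabs (X k)) N - sum_n (fun k => X k * cos (INR k * t)) N <= S - U).
  { apply H4. intros n. rewrite !sum_Sn. change (@plus _ ?a ?b) with (a + b).
    assert (X (Datatypes.S n) * cos (INR (Datatypes.S n) * t) <= Rabs (X (Datatypes.S n))); [|lra].
    eapply Rle_trans; [apply Rle_abs|]. rewrite Rabs_mult.
    rewrite <- (Rmult_1_r (Rabs (X (Datatypes.S n)))) at 2.
    apply Rmult_le_compat_l; [apply Rabs_pos|]. apply Rabs_le, COS_bound. }
  lra.
Qed.

(** The finite pairing applies to the corrected truncations, and the corrections [dX] and [dT] tend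
    to 0. *)
Lemma cos_series_pairing_nonneg (X T : nat -> R) (P : R) :
  ex_series (fun n => Rabs (X n)) -> ex_series (fun n => Rabs (T n)) ->
  (forall t, 0 <= Series (fun n => X n * cos (INR n * t))) ->
  (forall t, 0 <= Series (fun n => T n * cos (INR n * t))) ->
  is_series (fun n => X n * T n) P ->
  0 <= X 0%nat * T 0%nat + P.
Proof.
  intros HX HT PX PT HP.
  set (dX := fun N => Series (fun k => Rabs (X k)) - sum_n (fun k => Rabs (X k)) N).
  set (dT := fun N => Series (fun k => Rabs (T k)) - sum_n (fun k => Rabs (T k)) N).
  assert (LX : is_lim_seq dX 0).
  { rewrite <- (Rminus_diag (Series (fun k => Rabs (X k)))).
    apply is_lim_seq_minus'; [apply is_lim_seq_const|apply (Series_correct _ HX)]. }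
  assert (LT : is_lim_seq dT 0).
  { rewrite <- (Rminus_diag (Series (fun k => Rabs (T k)))).
    apply is_lim_seq_minus'; [apply is_lim_seq_const|apply (Series_correct _ HT)]. }
  (* The factor 2 arises because the corrected heads enter both the separate product and the term of
     index 0 in the sum. *)
  assert (L : is_lim_seq (fun N => 2 * (dX N * T 0%nat + dT N * X 0%nat + dX N * dT N)
                 + X 0%nat * T 0%nat + sum_n (fun n => X n * T n) N)
                (2 * (0 * T 0%nat + 0 * X 0%nat + 0 * 0) + X 0%nat * T 0%nat + P)).
  { repeat first [exact LX | exact LT | exact HP | apply is_lim_seq_const
                 | apply is_lim_seq_plus' | apply is_lim_seq_mult']. }
  replace (X 0%nat * T 0%nat + P)
    with (2 * (0 * T 0%nat + 0 * X 0%nat + 0 * 0) + X 0%nat * T 0%nat + P) by ring.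
  apply (is_lim_seq_le (fun _ => 0) _ 0 _) with (2 := is_lim_seq_const 0) (3 := L).
  intros N.
  assert (H := cos_poly_pairing_nonneg (add_head (dX N) X) (add_head (dT N) T) N
    (fun t => cos_sum_add_tail_nonneg X N t HX (PX t))
    (fun t => cos_sum_add_tail_nonneg T N t HT (PT t))).
  rewrite sum_n_add_head_mult in H.
  rewrite (sum_n_ext _ (fun n => add_head (dT N) T n * X n)) in H by (intros; apply Rmult_comm).
  rewrite sum_n_add_head_mult in H.
  rewrite (sum_n_ext _ (fun n => X n * T n)) in H by (intros; apply Rmult_comm).
  simpl add_head in H. lra.
Qed.

(** * Division of the coefficients by a linear function *)

Lemma is_derive_left_min_nonpos (y : R -> R) (c l : R) :
  is_derive y c l -> 0 < c -> (forall s, 0 <= s <= c -> y c <= y s) -> l <= 0.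
Proof.
  intros Hd Hc Hmin. apply Rnot_lt_le. intros Hl.
  apply is_derive_Reals in Hd.
  destruct (Hd (l / 2) ltac:(lra)) as [d Hd'].
  assert (Hd0 := cond_pos d).
  (* The step [- e] stays within the tolerance [d] and keeps [c - e] in [[0, c]], where minimality
     makes the left difference quotient at most 0. *)
  set (e := Rmin (d / 2) c).
  assert (He : 0 < e) by (apply Rmin_pos; lra).
  assert (He1 := Rmin_l (d / 2) c). assert (He2 := Rmin_r (d / 2) c). fold e in He1, He2.
  specialize (Hd' (- e) ltac:(lra) ltac:(rewrite Rabs_Ropp, Rabs_pos_eq; lra)).
  specialize (Hmin (c + - e) ltac:(lra)).
  apply Rabs_def2 in Hd'. destruct Hd' as [_ Hd'].
  assert ((y (c + - e) - y c) / - e <= 0); [|lra].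
  replace ((y (c + - e) - y c) / - e) with (- ((y (c + - e) - y c) * / e)) by (field; lra).
  assert (0 <= (y (c + - e) - y c) * / e); [|lra].
  apply Rmult_le_pos; [lra|]. left. now apply Rinv_0_lt_compat.
Qed.

(* At a negative minimum [c] over [[0, s]] both [y c] and [y' c] are at most [0];
   tilting [y] by a small linear term makes the differential inequality strict there. *)
Lemma euler_inequality_nonneg (beta gamma : R) (y dy : R -> R) :
  0 < beta -> 0 <= gamma -> y 0 = 0 ->
  (forall s, 0 <= s < 1 -> is_derive y s (dy s)) ->
  (forall s, 0 <= s < 1 -> 0 <= beta * s * dy s + gamma * y s) ->
  forall s, 0 <= s < 1 -> 0 <= y s.
Proof.
  intros Hb Hg Hy0 Hdy Hode s Hs. apply Rnot_lt_le. intros Hneg.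
  (* With this slope [z s = y s (1 - s / 2)] is still negative, so the minimum of [z] is not at
     0. *)
  set (e := - y s / 2).
  assert (He : 0 < e) by (unfold e; lra).
  set (z := fun t => y t + e * t).
  assert (Hdz : forall t, 0 <= t < 1 -> is_derive z t (dy t + e)).
  { intros t Ht. apply (is_derive_plus y (fun t => e * t) t (dy t) e (Hdy t Ht)).
    auto_derive; trivial. ring. }
  destruct (continuity_ab_min z 0 s) as [c [Hmin Hc]]; [lra| |].
  { intros t Ht. apply continuity_pt_filterlim.
    apply (ex_derive_continuous z). eexists. apply Hdz. lra. }
  assert (Hzs : z s < 0) by (unfold z, e; nra).
  assert (Hzc := Hmin s ltac:(lra)).
  assert (Hc0 : 0 < c).
  { destruct (Req_dec c 0) as [E|E]; [|lra].
    rewrite E in Hzc. unfold z at 1 in Hzc. rewrite Hy0 in Hzc. lra. }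
  assert (Hl : dy c + e <= 0).
  { apply (is_derive_left_min_nonpos z c); [apply Hdz; lra|easy|].
    intros t Ht. apply Hmin. lra. }
  specialize (Hode c ltac:(lra)).
  assert (Hyc : y c <= 0).
  { unfold z in *. assert (0 <= e * c) by (apply Rmult_le_pos; lra). lra. }
  assert (0 <= beta * c * - (dy c + e)) by (apply Rmult_le_pos; [apply Rmult_le_pos|]; lra).
  assert (0 < beta * c * e) by (apply Rmult_lt_0_compat; [apply Rmult_lt_0_compat|]; lra).
  assert (0 <= gamma * - y c) by (apply Rmult_le_pos; lra).
  nra.
Qed.

Lemma Rlt_CV_radius_bounded (a : nat -> R) (B r : R) :
  (forall n, Rabs (a n) <= B) -> 0 <= r < 1 -> Rbar_lt r (CV_radius a).
Proof.
  intros Ha. revert r. apply CV_radius_ge_1. intros r Hr. exists B. intros n.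
  rewrite Rabs_mult, <- RPow_abs, (Rabs_pos_eq r) by lra.
  rewrite <- (Rmult_1_r B). apply Rmult_le_compat.
  - apply Rabs_pos.
  - apply pow_le; lra.
  - apply Ha.
  - rewrite <- (pow1 n). apply pow_incr; lra.
Qed.

(** The quotient series solves the Euler equation [beta s y' + gamma y = q]. The condition [q 0 = 0]
    gives [y 0 = 0] even when [gamma = 0] and the denominator vanishes at index 0. The coefficient
    bound is returned so that the lemma can be applied again. *)
Lemma PSeries_div_linear_nonneg (beta gamma B : R) (q : nat -> R) :
  0 < beta -> 0 <= gamma -> q 0%nat = 0 -> (forall n, Rabs (q n) <= B) ->
  (forall s, 0 <= s < 1 -> 0 <= PSeries q s) ->
  (forall n, Rabs (q n / (beta * INR n + gamma)) <= B / beta) /\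
  (forall s, 0 <= s < 1 -> 0 <= PSeries (fun n => q n / (beta * INR n + gamma)) s).
Proof.
  intros Hb Hg Hq0 HB Hq.
  set (y := fun n => q n / (beta * INR n + gamma)).
  assert (Hy0 : y 0%nat = 0) by (unfold y, Rdiv; rewrite Hq0; ring).
  assert (Hden : forall n, beta <= beta * INR (S n) + gamma).
  { intros n. rewrite S_INR. assert (H := pos_INR n). nra. }
  assert (Hy : forall n, Rabs (y n) <= B / beta).
  { intros [|n].
    - rewrite Hy0, Rabs_R0. specialize (HB 0%nat). rewrite Hq0, Rabs_R0 in HB.
      apply Rmult_le_pos; [easy|]. left. now apply Rinv_0_lt_compat.
    - specialize (Hden n). unfold y, Rdiv. rewrite Rabs_mult.
      apply Rmult_le_compat; try apply Rabs_pos; trivial.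
      rewrite Rabs_pos_eq; [|left; apply Rinv_0_lt_compat; lra].
      apply Rinv_le_contravar; lra. }
  split; [exact Hy|].
  apply (euler_inequality_nonneg beta gamma (PSeries y) (PSeries (PS_derive y))); trivial.
  - rewrite PSeries_0. exact Hy0.
  - intros s Hs. apply is_derive_PSeries. rewrite Rabs_pos_eq by easy.
    now apply Rlt_CV_radius_bounded with (B / beta).
  - intros s Hs. replace (_ + _) with (PSeries q s); [now apply Hq|].
    assert (Hr : Rbar_lt (Rabs s) (CV_radius y)).
    { rewrite Rabs_pos_eq by easy. now apply Rlt_CV_radius_bounded with (B / beta). }
    assert (E1 := CV_radius_inside y s Hr).
    assert (E2 : ex_pseries (PS_derive y) s).
    { apply CV_radius_inside. now rewrite CV_radius_derive. }
    apply PSeries_correct in E1. apply PSeries_correct in E2.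
    apply is_pseries_R in E1. apply is_pseries_incr_1, is_pseries_R in E2.
    apply is_series_unique.
    assert (E3 : is_series
        (fun n => beta * (PS_incr_1 (PS_derive y) n * s ^ n) + gamma * (y n * s ^ n))
        (beta * (s * PSeries (PS_derive y) s) + gamma * PSeries y s)).
    { apply (is_series_plus (V := R_NormedModule)).
      - exact (is_series_scal (V := R_NormedModule) beta _ _ E2).
      - exact (is_series_scal (V := R_NormedModule) gamma _ _ E1). }
    rewrite <- Rmult_assoc in E3.
    revert E3. apply is_series_ext. intros n. eq_as R.
    destruct n as [|n].
    + simpl PS_incr_1. rewrite Hy0, Hq0. change (@zero _) with 0. ring.
    + specialize (Hden n). unfold PS_incr_1, PS_derive, y. field. lra.
Qed.

(** * Functions with nonnegative real part *)

Lemma cis_plus (s t : R) : cis (s + t) = (cis s * cis t)%C.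
Proof.
  unfold cis, Cmult. simpl. rewrite cos_plus, sin_plus. f_equal; ring.
Qed.

Lemma cis_0 : cis 0 = RtoC 1.
Proof. unfold cis. now rewrite cos_0, sin_0. Qed.

Lemma cis_pow (t : R) (n : nat) : (cis t ^ n)%C = cis (INR n * t).
Proof.
  induction n as [|n IH].
  - simpl. now rewrite Rmult_0_l, cis_0.
  - rewrite Cpow_S, IH, <- cis_plus, S_INR. f_equal. ring.
Qed.

Lemma Cmod_cis (t : R) : Cmod (cis t) = 1.
Proof.
  unfold Cmod, cis. simpl fst. simpl snd. rewrite <- sqrt_1. f_equal.
  rewrite <- !Rsqr_pow2, Rplus_comm. apply sin2_cos2.
Qed.

Lemma polar_form (z : C) : exists t, z = (RtoC (Cmod z) * cis t)%C.
Proof.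
  destruct (Req_dec (Cmod z) 0) as [E|E].
  - exists 0. rewrite E. rewrite (Cmod_eq_0 z E). ring.
  - assert (Hp := Cmod_ge_0 z).
    set (r := Cmod z) in *. set (x := Re z / r). set (y := Im z / r).
    assert (Hxy : x * x + y * y = 1).
    { unfold x, y. assert (H := Cmod2_alt z). fold r in H.
      replace (Re z / r * (Re z / r) + Im z / r * (Im z / r))
        with ((Re z ^ 2 + Im z ^ 2) / r ^ 2) by (field; easy).
      rewrite <- H. now field. }
    assert (Hx : -1 <= x <= 1) by nra.
    assert (Hz : z = (RtoC r * (x, y))%C).
    { unfold x, y. rewrite (surjective_pairing z). unfold Cmult, Re, Im. simpl.
      f_equal; now field. }
    destruct (Rle_dec 0 y) as [Hy|Hy].
    (* [acos] covers the upper half circle; the lower half uses the opposite angle. *)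
    + exists (acos x). rewrite Hz at 1. unfold cis. rewrite cos_acos, sin_acos by easy.
      do 2 f_equal. rewrite <- (sqrt_Rsqr y Hy). f_equal. unfold Rsqr. lra.
    + exists (- acos x). rewrite Hz at 1. unfold cis.
      rewrite cos_neg, sin_neg, cos_acos, sin_acos by easy.
      do 2 f_equal. rewrite <- (Ropp_involutive y). f_equal.
      rewrite <- (sqrt_Rsqr (- y)) by lra. f_equal. unfold Rsqr. lra.
Qed.

(** * The geometric series and the growth kernel *)

Lemma geometric_Cpseries (z : C) :
  in_disk z -> exists l, is_Cpseries (fun _ => RtoC 1) z l /\ (l * (1 - z) = 1)%C.
Proof.
  intros Hz.
  destruct (converges_on_disk_bound (fun _ => RtoC 1) (fun _ => 1)) with z as [l Hl]; trivial.
  - intros n. rewrite Cmod_1. apply Rle_refl.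
  - intros r. apply Rlt_CV_radius_bounded with 1. intros n. rewrite Rabs_R1. apply Rle_refl.
  - exists l. split; [exact Hl|].
    assert (H1 := is_Cseries_incr _ _ Hl).
    assert (H2 := is_Cseries_scal z _ _ Hl).
    (* Dropping the first term of the geometric series is the same as multiplying it by [z]. *)
    assert (E : (l - 1 * z ^ 0 = z * l)%C).
    { refine (is_Cseries_unique _ _ _ H1 _). revert H2. apply is_Cseries_ext; trivial.
      intros n. simpl. ring. }
    simpl in E. replace (l * (1 - z))%C with (l - 1 * 1 - z * l + 1)%C by ring.
    rewrite E. ring.
Qed.

(** The map [1 / (1 - z)] sends the circle [|z| = r] to the circle with diameter
    [[1 / (1 + r), 1 / (1 - r)]]. *)
Lemma Re_geometric_ge (z l : C) :
  in_disk z -> (l * (1 - z) = 1)%C -> / (1 + Cmod z) <= Re l.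
Proof.
  intros Hz Hl. unfold in_disk in Hz.
  assert (Hr := Cmod_ge_0 z). set (r := Cmod z) in *.
  assert (E : (l - 1 = l * z)%C).
  { rewrite <- Hl. ring. }
  assert (E1 : Cmod (l - 1) ^ 2 = r ^ 2 * Cmod l ^ 2).
  { rewrite E, Cmod_mult. fold r. ring. }
  rewrite !Cmod2_alt in E1. destruct l as [x y]. unfold Re, Im in *. simpl in E1 |- *.
  apply Rmult_le_reg_l with (1 + r); [lra|]. rewrite Rinv_r by lra.
  (* The identity [|l - 1| = r |l|] amounts to [(1 - x (1 - r)) (1 - x (1 + r)) + y^2 (1 - r^2) =
     0]; if [x (1 + r) < 1], both factors of the product are positive, a contradiction. *)
  apply Rnot_lt_le. intros H.
  assert (0 < 1 - x * (1 - r)) by nra.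
  assert (0 < (1 - x * (1 - r)) * (1 - (1 + r) * x)) by (apply Rmult_lt_0_compat; lra).
  assert (0 <= y * y * (1 - r * r)) by (apply Rmult_le_pos; nra).
  nra.
Qed.

Lemma is_series_cos_geometric (t s : R) : 0 <= s < 1 ->
  exists u, is_pseries (fun n => cos (INR n * t)) s u /\ / (1 + s) <= u.
Proof.
  intros Hs. set (z := (RtoC s * cis t)%C).
  assert (Hz : Cmod z = s).
  { unfold z. rewrite Cmod_mult, Cmod_R, Cmod_cis, Rabs_pos_eq; lra. }
  destruct (geometric_Cpseries z) as [l [Hl El]]; [unfold in_disk; lra|].
  exists (Re l). split.
  - apply is_pseries_R. apply is_Cseries_Re in Hl. revert Hl.
    apply is_series_ext. intros n. unfold z. rewrite Cpow_mult_l, cis_pow, <- RtoC_pow.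
    unfold cis. simpl. eq_as R. ring.
  - rewrite <- Hz. apply Re_geometric_ge; trivial. unfold in_disk; lra.
Qed.

(** The sum of [s^n cos (n t)] is least at [t = PI], where it equals [1 / (1 + s)]; the signs
    [(-1)^n] subtract exactly this minimum. *)
Lemma PSeries_cos_minus_sign_nonneg (t s : R) : 0 <= s < 1 ->
  0 <= PSeries (fun n => cos (INR n * t) - (-1) ^ n) s.
Proof.
  intros Hs. destruct (is_series_cos_geometric t s Hs) as [u [Hu Hle]].
  assert (H2 : is_pseries (fun n => (-1) ^ n) s (/ (1 + s))).
  { apply is_pseries_R. replace (1 + s) with (1 - - s) by ring.
    apply is_series_ext with (fun n => (- s) ^ n).
    - intros n. rewrite <- Rpow_mult_distr. eq_as R. f_equal. ring.
    - apply is_series_geom. rewrite Rabs_Ropp, Rabs_pos_eq; lra. }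
  assert (H := is_pseries_minus _ _ _ _ _ Hu H2).
  apply is_pseries_unique in H.
  change (PSeries (fun n => cos (INR n * t) - (-1) ^ n) s = u - / (1 + s)) in H.
  rewrite H. lra.
Qed.

(* The [k]-th Taylor coefficients of [F z / z] and of the operator applied to [F] differ
   by the factor [coef_den alpha (k + 1)]; at [k = 0] it vanishes when [alpha = 1], and the
   value [0] is chosen instead. *)
Definition growth_coef (alpha : R) (k : nat) : R :=
  match k with O => 0 | S _ => / coef_den alpha (S k) end.

Lemma coef_den_ge_1 (alpha : R) (k : nat) : 0 < alpha -> 1 <= coef_den alpha (S (S k)).
Proof.
  intros Ha. unfold coef_den. rewrite !S_INR. assert (H := pos_INR k).
  set (x := INR k) in *. replace (x + 1 + 1 - 2) with x by ring.
  assert (0 <= alpha * x) by (apply Rmult_le_pos; lra). nra.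
Qed.

Lemma growth_coef_bound (alpha : R) (k : nat) : 0 < alpha -> 0 <= growth_coef alpha k <= 1.
Proof.
  intros Ha. destruct k as [|k]; simpl growth_coef; [lra|].
  assert (H := coef_den_ge_1 alpha k Ha). split.
  - left. apply Rinv_0_lt_compat. lra.
  - rewrite <- Rinv_1. apply Rinv_le_contravar; lra.
Qed.

Lemma Rlt_CV_radius_growth_coef (alpha r : R) :
  0 < alpha -> 0 <= r < 1 -> Rbar_lt r (CV_radius (growth_coef alpha)).
Proof.
  intros Ha. apply Rlt_CV_radius_bounded with 1. intros n.
  assert (H := growth_coef_bound alpha n Ha). rewrite Rabs_pos_eq; lra.
Qed.

(** Since [coef_den alpha (n + 1) = (alpha n + (1 - alpha)) (n + 1)], two divisions by linear
    functions of [n] lead from the Poisson kernel to this one. *)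
Lemma growth_kernel_nonneg (alpha t s : R) : 0 < alpha <= 1 -> 0 <= s < 1 ->
  0 <= PSeries (fun n => growth_coef alpha n * (cos (INR n * t) - (-1) ^ n)) s.
Proof.
  intros Ha Hs. set (q := fun n => cos (INR n * t) - (-1) ^ n).
  assert (Hq0 : q 0%nat = 0).
  { unfold q. simpl. rewrite Rmult_0_l, cos_0. ring. }
  assert (Hq : forall n, Rabs (q n) <= 2).
  { intros n. unfold q. eapply Rle_trans; [apply Rabs_triang|].
    rewrite Rabs_Ropp, pow_1_abs.
    assert (Rabs (cos (INR n * t)) <= 1) by apply Rabs_le, COS_bound. lra. }
  destruct (PSeries_div_linear_nonneg alpha (1 - alpha) 2 q) as [B1 P1]; try lra; trivial.
  { intros; now apply PSeries_cos_minus_sign_nonneg. }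
  destruct (PSeries_div_linear_nonneg 1 1 (2 / alpha)
              (fun n => q n / (alpha * INR n + (1 - alpha)))) as [_ P2]; try lra; trivial.
  { unfold Rdiv. rewrite Hq0. ring. }
  (* At index 0 both sides vanish because [q 0 = 0], whatever value [growth_coef] takes there. *)
  erewrite PSeries_ext; [exact (P2 s Hs)|].
  intros [|n]; simpl growth_coef; fold (q 0%nat).
  - rewrite Hq0. unfold Rdiv. ring.
  - fold (q (S n)). assert (H := coef_den_ge_1 alpha n ltac:(lra)).
    unfold coef_den in H |- *. rewrite !S_INR in *. assert (Hn := pos_INR n).
    assert (0 < alpha * (INR n + 1) + (1 - alpha)) by nra.
    field. repeat split; try lra.
Qed.

(** * Carathéodory inequalities from the pairing *)

Lemma Re_mult_pow_cis (c : C) (r t : R) (n : nat) :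
  Re (c * (RtoC r * cis t) ^ n)%C
  = r ^ n * (Re c * cos (INR n * t) - Im c * sin (INR n * t)).
Proof.
  rewrite Cpow_mult_l, cis_pow, <- RtoC_pow. destruct c. unfold cis, Re, Im. simpl. ring.
Qed.

(* Averaging [u] over the points [r zeta cis t] and [r zeta cis (- t)] cancels the sines. *)
Lemma Re_nonneg_cos_series (d : nat -> C) (u : C -> C) (zeta : C) (r t : R) :
  (forall w, in_disk w -> is_Cpseries d w (u w)) ->
  (forall w, in_disk w -> 0 <= Re (u w)) ->
  Cmod zeta = 1 -> 0 <= r < 1 ->
  0 <= Series (fun n => Re (d n * zeta ^ n)%C * r ^ n * cos (INR n * t)).
Proof.
  intros Hd Hu Hz Hr.
  assert (Hw : forall x, in_disk (zeta * (RtoC r * cis x))%C).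
  { intros x. unfold in_disk. rewrite !Cmod_mult, Hz, Cmod_cis, Cmod_R, Rabs_pos_eq; lra. }
  assert (H : forall x, is_series
      (fun n => r ^ n * (Re (d n * zeta ^ n)%C * cos (INR n * x)
                         - Im (d n * zeta ^ n)%C * sin (INR n * x)))
      (Re (u (zeta * (RtoC r * cis x))%C))).
  { intros x. generalize (is_Cseries_Re _ _ (Hd _ (Hw x))). apply is_series_ext.
    intros n. rewrite <- Re_mult_pow_cis. eq_as R. f_equal.
    rewrite (Cpow_mult_l zeta). ring. }
  assert (E := is_series_unique _ _
    (is_series_scal (V := R_NormedModule) (/ 2) _ _
      (is_series_plus (V := R_NormedModule) _ _ _ _ (H t) (H (- t))))).
  erewrite Series_ext.
  - rewrite E. assert (H1 := Hu _ (Hw t)). assert (H2 := Hu _ (Hw (- t))).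
    apply Rmult_le_pos; [lra|]. now apply Rplus_le_le_0_compat.
  - intros n. change (@scal _ _ ?a ?b) with (a * b). change (@plus _ ?a ?b) with (a + b).
    cbv beta. rewrite <- Ropp_mult_distr_r, cos_neg, sin_neg. eq_as R. field.
Qed.

(** Here [zeta] fixes the direction in which coefficients are tested, and [r < 1] makes
    [Re (d_n zeta^n) r^n] absolutely summable. *)
Lemma caratheodory_pairing (d : nat -> C) (u : C -> C) (T : nat -> R) (zeta : C) (r P : R) :
  (forall w, in_disk w -> is_Cpseries d w (u w)) ->
  (forall w, in_disk w -> 0 <= Re (u w)) ->
  Cmod zeta = 1 -> 0 <= r < 1 ->
  ex_series (fun n => Rabs (T n)) ->
  (forall t, 0 <= Series (fun n => T n * cos (INR n * t))) ->
  is_series (fun n => Re (d n * zeta ^ n)%C * r ^ n * T n) P ->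
  0 <= Re (d 0%nat) * T 0%nat + P.
Proof.
  intros Hd Hu Hz Hr HT PT HP.
  replace (Re (d 0%nat)) with (Re (d 0%nat * zeta ^ 0)%C * r ^ 0)
    by (simpl Cpow; rewrite Cmult_1_r; simpl; ring).
  apply (cos_series_pairing_nonneg (fun n => Re (d n * zeta ^ n)%C * r ^ n) T); trivial.
  - apply (ex_series_le (V := R_CompleteNormedModule) _ (fun n => Cmod (d n) * r ^ n)).
    + intros n. change (Rabs (Rabs (Re (d n * zeta ^ n)%C * r ^ n)) <= Cmod (d n) * r ^ n).
      rewrite Rabs_Rabsolu, Rabs_mult, (Rabs_pos_eq (r ^ n)) by (apply pow_le; lra).
      apply Rmult_le_compat_r; [apply pow_le; lra|].
      eapply Rle_trans; [apply re_le_Cmod|].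
      rewrite Cmod_mult, Cmod_pow, Hz, pow1, Rmult_1_r. apply Rle_refl.
    + apply ex_series_Cmod_pow; trivial. intros w Hw. exists (u w). auto.
  - intros t. now apply Re_nonneg_cos_series with u.
Qed.

(** Added to another series, this alters a single coefficient. *)
Lemma is_series_delta (k : nat) (v : R) :
  is_series (fun n => if (n =? k)%nat then v else 0) v.
Proof.
  assert (E : forall n, sum_n (fun n => if (n =? k)%nat then v else 0) n
                        = if (k <=? n)%nat then v else 0).
  { intros n. induction n as [|n IH].
    - rewrite sum_O. destruct (Nat.eqb_spec 0 k), (Nat.leb_spec k 0); trivial; lia.
    - rewrite sum_Sn, IH. eq_as R. change (@plus _ ?a ?b) with (a + b).
      destruct (Nat.eqb_spec (S n) k), (Nat.leb_spec k (S n)), (Nat.leb_spec k n);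
        try lia; ring. }
  change (is_lim_seq (sum_n (fun n => if (n =? k)%nat then v else 0)) v).
  apply (is_lim_seq_ext_loc (fun _ => v)); [|apply is_lim_seq_const].
  exists k. intros n Hn. rewrite E. destruct (Nat.leb_spec k n); [easy|lia].
Qed.

(** Carries inequalities proved at auxiliary radii over to the limiting radius. *)
Lemma continuous_le_limit (f : R -> R) (r B : R) :
  continuity_pt f r ->
  (forall e, 0 < e -> exists s, Rabs (s - r) < e /\ f s <= B) -> f r <= B.
Proof.
  intros Hf H. apply Rnot_lt_le. intros Hlt.
  destruct (Hf (f r - B)) as [e [He Hc]]; [lra|].
  destruct (H e He) as [s [Hs Hle]].
  (* The limit in [continuity_pt] is over points distinct from [r], so [s = r] is treated apart. *)
  destruct (Req_dec r s) as [E|E]; [subst; lra|].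
  assert (Hd : R_dist (f s) (f r) < f r - B).
  { apply Hc. split; [split; trivial; exact I|exact Hs]. }
  unfold R_dist in Hd. apply Rabs_def2 in Hd. lra.
Qed.

(** Pairing with [1 - cos ((k + 1) t)] yields [|d_(k+1)| r^(k+1) <= 2 Re d_0], and then [r] tends to
    1. *)
Lemma caratheodory_coef_bound (d : nat -> C) (u : C -> C) (k : nat) :
  (forall w, in_disk w -> is_Cpseries d w (u w)) ->
  (forall w, in_disk w -> 0 <= Re (u w)) ->
  Cmod (d (S k)) <= 2 * Re (d 0%nat).
Proof.
  intros Hd Hu. destruct (polar_form (d (S k))) as [t Ht].
  (* This rotation makes [d_(k+1) zeta^(k+1)] equal to its modulus. *)
  set (zeta := cis (- t / INR (S k))).
  assert (Hk : INR (S k) <> 0) by (apply not_0_INR; lia).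
  assert (Hz : Re (d (S k) * zeta ^ S k)%C = Cmod (d (S k))).
  { unfold zeta. rewrite cis_pow, Ht at 1. rewrite <- Cmult_assoc, <- cis_plus.
    replace (t + INR (S k) * (- t / INR (S k))) with 0 by (field; trivial).
    rewrite cis_0, Cmult_1_r. reflexivity. }
  set (T := fun n => (if (n =? 0)%nat then 1 else 0) + (if (n =? S k)%nat then -1 else 0)).
  assert (main : forall r, 0 <= r < 1 -> Cmod (d (S k)) * r ^ S k <= 2 * Re (d 0%nat)).
  { intros r Hr.
    assert (H := caratheodory_pairing d u T zeta r
                   (Re (d 0%nat) + - (Cmod (d (S k)) * r ^ S k)) Hd Hu (Cmod_cis _) Hr).
    assert (HT0 : T 0%nat = 1) by (unfold T; simpl; ring).
    rewrite HT0 in H.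
    assert (0 <= Re (d 0%nat) * 1 + (Re (d 0%nat) + - (Cmod (d (S k)) * r ^ S k))); [|lra].
    apply H.
    - eexists. apply is_series_ext with
        (2 := is_series_plus (V := R_NormedModule) _ _ _ _
                (is_series_delta 0 1) (is_series_delta (S k) 1)).
      intros n. eq_as R. change (@plus _ ?a ?b) with (a + b). unfold T.
      destruct (Nat.eqb_spec n 0), (Nat.eqb_spec n (S k)); try lia;
        rewrite ?Rplus_0_l, ?Rplus_0_r, ?Rabs_R0, ?Rabs_R1, ?Rabs_m1; trivial.
    - intros x.
      rewrite (is_series_unique _ (1 + - cos (INR (S k) * x))).
      + assert (B := COS_bound (INR (S k) * x)). lra.
      + apply is_series_ext with
          (2 := is_series_plus (V := R_NormedModule) _ _ _ _
                  (is_series_delta 0 1) (is_series_delta (S k) (- cos (INR (S k) * x)))).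
        intros n. eq_as R. change (@plus _ ?a ?b) with (a + b). unfold T.
        destruct (Nat.eqb_spec n 0), (Nat.eqb_spec n (S k)); try lia; subst; try ring.
        simpl INR. rewrite Rmult_0_l, cos_0. ring.
    - apply is_series_ext with
          (2 := is_series_plus (V := R_NormedModule) _ _ _ _
                  (is_series_delta 0 (Re (d 0%nat)))
                  (is_series_delta (S k) (- (Cmod (d (S k)) * r ^ S k)))).
      intros n. eq_as R. change (@plus _ ?a ?b) with (a + b). unfold T.
      destruct (Nat.eqb_spec n 0), (Nat.eqb_spec n (S k)); try lia; subst; try ring.
      + simpl Cpow. rewrite Cmult_1_r. simpl pow. ring.
      + rewrite Hz. ring. }
  replace (Cmod (d (S k))) with (Cmod (d (S k)) * 1 ^ S k) by (rewrite pow1; ring).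
  apply (continuous_le_limit (fun r => Cmod (d (S k)) * r ^ S k) 1).
  - apply continuity_pt_filterlim.
    apply (ex_derive_continuous (fun r => Cmod (d (S k)) * r ^ S k)). auto_derive. easy.
  (* The cap at 1 keeps the radius nonnegative. *)
  - intros e He. exists (1 - Rmin (e / 2) 1).
    assert (0 < Rmin (e / 2) 1) by (apply Rmin_pos; lra).
    assert (H1 := Rmin_l (e / 2) 1). assert (H2 := Rmin_r (e / 2) 1).
    split; [|apply main; lra].
    rewrite Rabs_minus_sym, Rabs_pos_eq; lra.
Qed.

(** * The growth bounds *)

Lemma ex_pseries_growth_coef (alpha x : R) :
  0 < alpha -> Rabs x < 1 -> ex_pseries (growth_coef alpha) x.
Proof.
  intros Ha Hx. apply CV_radius_inside. apply Rlt_CV_radius_growth_coef; trivial.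
  split; [apply Rabs_pos|easy].
Qed.

(** One factor [x] is taken out to match [F z / z]. The term of index [k] comes from [growth_coef]
    at [k + 1], the value at 0 being 0. *)
Lemma is_series_pow_div_coef_den (alpha x : R) : 0 < alpha -> Rabs x < 1 ->
  is_series (fun k => x ^ (k + 2) / coef_den alpha (k + 2)) (x * PSeries (growth_coef alpha) x).
Proof.
  intros Ha Hx.
  assert (H := PSeries_correct _ _ (ex_pseries_growth_coef alpha x Ha Hx)).
  apply is_pseries_R in H.
  assert (H1 : is_series (fun k => growth_coef alpha (S k) * x ^ S k) (PSeries (growth_coef alpha) x)).
  { apply (is_series_incr_1 (V := R_NormedModule) (fun k => growth_coef alpha k * x ^ k)).
    replace (plus _ _) with (PSeries (growth_coef alpha) x); [exact H|].
    eq_as R. change (@plus _ ?a ?b) with (a + b). simpl. ring. }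
  generalize (is_series_scal (V := R_NormedModule) x _ _ H1). apply is_series_ext.
  intros k. eq_as R. change (@scal _ _ ?a ?b) with (a * b).
  replace (k + 2)%nat with (S (S k)) by lia. unfold growth_coef, Rdiv. simpl pow. ring.
Qed.

Lemma upper_bound_PSeries (alpha M r : R) : 0 < alpha -> 0 <= r < 1 ->
  upper_bound alpha M r = r * (1 + 2 * (M - alpha + 1) * PSeries (growth_coef alpha) r).
Proof.
  intros Ha Hr. unfold upper_bound.
  rewrite (is_series_unique _ _ (is_series_pow_div_coef_den alpha r Ha
             ltac:(rewrite Rabs_pos_eq; lra))).
  ring.
Qed.

(** This is the preceding series at [- r], since [(-1)^(n-1) r^n = - (- r)^n]. *)
Lemma is_series_lower_bound (alpha r : R) : 0 < alpha -> 0 <= r < 1 ->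
  is_series (fun k => (-1) ^ (k + 2 - 1) * r ^ (k + 2) / coef_den alpha (k + 2))
    (r * PSeries (growth_coef alpha) (- r)).
Proof.
  intros Ha Hr.
  assert (H := is_series_pow_div_coef_den alpha (- r) Ha
                 ltac:(rewrite Rabs_Ropp, Rabs_pos_eq; lra)).
  apply (is_series_scal (V := R_NormedModule) (-1)) in H.
  replace (r * PSeries (growth_coef alpha) (- r))
    with (-1 * (- r * PSeries (growth_coef alpha) (- r))) by ring.
  revert H. apply is_series_ext. intros k. eq_as R. change (@scal _ _ ?a ?b) with (a * b).
  replace (- r) with (-1 * r) by ring. rewrite Rpow_mult_distr.
  replace (k + 2 - 1)%nat with (S k) by lia. replace (k + 2)%nat with (S (S k)) by lia.
  simpl pow. unfold Rdiv. ring.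
Qed.

Lemma lower_bound_PSeries (alpha M r : R) : 0 < alpha -> 0 <= r < 1 ->
  lower_bound alpha M r = r * (1 + 2 * (M - alpha + 1) * PSeries (growth_coef alpha) (- r)).
Proof.
  intros Ha Hr. unfold lower_bound.
  rewrite (is_series_unique _ _ (is_series_lower_bound alpha r Ha Hr)). ring.
Qed.

Definition const_coef (c : C) (n : nat) : C := match n with O => c | S _ => RtoC 0 end.

Lemma is_Cpseries_const (c z : C) : is_Cpseries (const_coef c) z c.
Proof.
  apply is_Cseries_pair.
  - apply is_series_ext with (2 := is_series_delta 0 (Re c)). intros [|n]; eq_as R.
    + simpl Cpow. rewrite Cmult_1_r. reflexivity.
    + simpl Nat.eqb. unfold const_coef. rewrite Cmult_0_l. reflexivity.
  - apply is_series_ext with (2 := is_series_delta 0 (Im c)). intros [|n]; eq_as R.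
    + simpl Cpow. rewrite Cmult_1_r. reflexivity.
    + simpl Nat.eqb. unfold const_coef. rewrite Cmult_0_l. reflexivity.
Qed.

Lemma Re_mult_RtoC (z : C) (k : R) : Re (z * RtoC k)%C = Re z * k.
Proof. unfold Re. simpl. ring. Qed.

(* The pairing needs absolutely convergent series, so [|z|] is split as [(|z| / s) * s] with
   [|z| < s < 1], and [s] tends to [|z|] at the end. *)
Lemma Re_quotient_ge (alpha m : R) (A d : nat -> C) (u : C -> C) (z phi : C) :
  0 < alpha <= 1 ->
  (forall w, in_disk w -> is_Cpseries d w (u w)) ->
  (forall w, in_disk w -> 0 <= Re (u w)) ->
  Re (d 0%nat) = m -> A 0%nat = RtoC 1 ->
  (forall n, d (S n) = RtoC (coef_den alpha (S (S n))) * A (S n))%C ->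
  in_disk z -> z <> RtoC 0 -> is_Cpseries A z phi ->
  1 + 2 * m * PSeries (growth_coef alpha) (- Cmod z) <= Re phi.
Proof.
  intros Ha Hd Hu Hd0 HA0 HdA Hz Hz0 Hphi. unfold in_disk in Hz.
  apply Cmod_gt_0 in Hz0. set (r := Cmod z) in *. set (a := growth_coef alpha).
  set (zeta := (z / RtoC r)%C).
  assert (Hr0 : RtoC r <> RtoC 0) by (intros K; injection K; lra).
  assert (Hzeta : Cmod zeta = 1).
  { unfold zeta. rewrite Cmod_div, Cmod_R, Rabs_pos_eq by (trivial; lra).
    fold r. field. lra. }
  assert (main : forall s, r < s < 1 -> 1 + 2 * m * PSeries a (- s) <= Re phi).
  { intros s Hs.
    assert (Hsum : is_series (fun n => a n * (- s) ^ n) (PSeries a (- s))).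
    { apply is_pseries_R, PSeries_correct, ex_pseries_growth_coef; [lra|].
      rewrite Rabs_Ropp, Rabs_pos_eq; lra. }
    (* Lowering the constant term by [PSeries a (- s)] turns the cosine series of [a n * s ^ n] into
       the growth kernel. *)
    set (T := fun n => a n * s ^ n + (if (n =? 0)%nat then - PSeries a (- s) else 0)).
    assert (HT0 : T 0%nat = - PSeries a (- s)) by (unfold T; simpl; ring).
    assert (Hpos : forall n, 0 <= a n * s ^ n).
    { intros n. apply Rmult_le_pos; [apply growth_coef_bound; lra|apply pow_le; lra]. }
    (* For [n >= 1] the paired terms are those of [Re phi]; at 0 the term is [m T_0] in place of 1.
       The pairing thus reads [2 m T_0 + Re phi - 1 >= 0]. *)
    assert (H := caratheodory_pairing d u T zeta (r / s) (Re phi + (m * T 0%nat - 1)) Hd Hu Hzeta).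
    rewrite Hd0 in H.
    assert (0 <= m * T 0%nat + (Re phi + (m * T 0%nat - 1))); [apply H|rewrite HT0 in *; lra].
    - split; [apply Rmult_le_pos; [lra|left; apply Rinv_0_lt_compat; lra]|].
      apply Rmult_lt_reg_r with s; [lra|]. unfold Rdiv. rewrite Rmult_assoc, Rinv_l; lra.
    - assert (Es : ex_series (fun n => a n * s ^ n)).
      { destruct (ex_pseries_growth_coef alpha s) as [l Hl]; [lra|rewrite Rabs_pos_eq; lra|].
        exists l. now apply is_pseries_R. }
      apply (ex_series_le (V := R_CompleteNormedModule) _
               (fun n => a n * s ^ n + (if (n =? 0)%nat then Rabs (PSeries a (- s)) else 0))).
      + intros n. change (Rabs (Rabs (T n)) <=
          a n * s ^ n + (if (n =? 0)%nat then Rabs (PSeries a (- s)) else 0)).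
        rewrite Rabs_Rabsolu. unfold T. eapply Rle_trans; [apply Rabs_triang|].
        rewrite (Rabs_pos_eq (a n * s ^ n)) by trivial.
        destruct (n =? 0)%nat; rewrite ?Rabs_Ropp, ?Rabs_R0; lra.
      + apply (ex_series_plus (V := R_NormedModule)); [exact Es|].
        eexists. apply is_series_delta.
    - intros t. set (K := fun n => a n * (cos (INR n * t) - (-1) ^ n)).
      assert (HK : is_series (fun n => K n * s ^ n) (PSeries K s)).
      { apply is_pseries_R, PSeries_correct, CV_radius_inside.
        rewrite Rabs_pos_eq by lra. apply Rlt_CV_radius_bounded with 2; [|lra].
        intros n. unfold K. rewrite Rabs_mult.
        assert (H1 := growth_coef_bound alpha n ltac:(lra)). fold a in H1.
        rewrite (Rabs_pos_eq (a n)) by lra.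
        assert (H2 : Rabs (cos (INR n * t) - (-1) ^ n) <= 2).
        { eapply Rle_trans; [apply Rabs_triang|]. rewrite Rabs_Ropp, pow_1_abs.
          assert (Rabs (cos (INR n * t)) <= 1) by apply Rabs_le, COS_bound. lra. }
        assert (H3 := Rabs_pos (cos (INR n * t) - (-1) ^ n)). nra. }
      rewrite (is_series_unique _ (PSeries K s + PSeries a (- s) + - PSeries a (- s))).
      + assert (P := growth_kernel_nonneg alpha t s Ha ltac:(lra)). fold a K in P. lra.
      + apply is_series_ext with
          (2 := is_series_plus (V := R_NormedModule) _ _ _ _
                  (is_series_plus (V := R_NormedModule) _ _ _ _ HK Hsum)
                  (is_series_delta 0 (- PSeries a (- s)))).
        intros n. eq_as R. change (@plus _ ?a ?b) with (a + b). unfold K, T.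
        replace (- s) with (-1 * s) at 1 by ring. rewrite Rpow_mult_distr.
        repeat change (@plus _ ?a ?b) with (a + b).
        destruct (Nat.eqb_spec n 0) as [->|_]; [simpl INR; rewrite (Rmult_0_l t), cos_0; simpl; ring|ring].
    - apply is_series_ext with
        (2 := is_series_plus (V := R_NormedModule) _ _ _ _
                (is_Cseries_Re _ _ Hphi) (is_series_delta 0 (m * T 0%nat - 1))).
      intros [|n]; eq_as R; change (@plus _ ?a ?b) with (a + b).
      + simpl Nat.eqb. cbv iota. rewrite HA0. simpl Cpow. rewrite !Cmult_1_r, Hd0.
        change (Re (RtoC 1)) with 1. simpl pow. ring.
      + simpl Nat.eqb. cbv iota. rewrite Rplus_0_r, HdA.
        unfold T. simpl Nat.eqb. cbv iota. rewrite Rplus_0_r, Rmult_assoc, <- Re_mult_RtoC.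
        f_equal. change (a (S n)) with (/ coef_den alpha (S (S n))).
        assert (Hden := coef_den_ge_1 alpha n ltac:(lra)).
        set (e := coef_den alpha (S (S n))) in *. set (N := S n).
        replace ((r / s) ^ N * (/ e * s ^ N)) with (/ e * r ^ N).
        2:{ replace r with (r / s * s) at 1 by (field; lra). rewrite Rpow_mult_distr. ring. }
        replace z with (zeta * RtoC r)%C at 1 by (unfold zeta; field; trivial).
        rewrite Cpow_mult_l, <- RtoC_pow, RtoC_mult, RtoC_inv by lra.
        field. intros E. injection E. lra. }
  apply (continuous_le_limit (fun s => 1 + 2 * m * PSeries a (- s)) r).
  - apply continuity_pt_filterlim.
    apply (ex_derive_continuous (fun s => 1 + 2 * m * PSeries a (- s))).
    auto_derive. apply ex_derive_PSeries.
    rewrite Rabs_Ropp, Rabs_pos_eq by lra. apply Rlt_CV_radius_growth_coef; lra.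
  - intros e He. exists (r + Rmin (e / 2) ((1 - r) / 2)).
    assert (0 < Rmin (e / 2) ((1 - r) / 2)) by (apply Rmin_pos; lra).
    assert (H1 := Rmin_l (e / 2) ((1 - r) / 2)). assert (H2 := Rmin_r (e / 2) ((1 - r) / 2)).
    split; [|apply main; lra].
    replace (r + _ - r) with (Rmin (e / 2) ((1 - r) / 2)) by ring. rewrite Rabs_pos_eq; lra.
Qed.

(** The coefficient bound gives [|A_n| <= 2 m growth_coef n] for [n >= 1]; the series is then
    estimated term by term. *)
Lemma Cmod_quotient_le (alpha m : R) (A d : nat -> C) (u : C -> C) (z phi : C) :
  0 < alpha <= 1 ->
  (forall w, in_disk w -> is_Cpseries d w (u w)) ->
  (forall w, in_disk w -> 0 <= Re (u w)) ->
  Re (d 0%nat) = m -> A 0%nat = RtoC 1 ->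
  (forall n, d (S n) = RtoC (coef_den alpha (S (S n))) * A (S n))%C ->
  in_disk z -> is_Cpseries A z phi ->
  Cmod phi <= 1 + 2 * m * PSeries (growth_coef alpha) (Cmod z).
Proof.
  intros Ha Hd Hu Hd0 HA0 HdA Hz Hphi. unfold in_disk in Hz. assert (Hr := Cmod_ge_0 z).
  assert (Hsum : is_series (fun n => growth_coef alpha n * Cmod z ^ n)
                   (PSeries (growth_coef alpha) (Cmod z))).
  { apply is_pseries_R, PSeries_correct, ex_pseries_growth_coef; [lra|].
    rewrite Rabs_pos_eq; lra. }
  refine (Cmod_Cseries_le _ _ _ _ Hphi _
            (is_series_plus (V := R_NormedModule) _ _ _ _ (is_series_delta 0 1)
               (is_series_scal (V := R_NormedModule) (2 * m) _ _ Hsum))).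
  intros n. change (@scal _ _ ?a ?b) with (a * b). change (@plus _ ?a ?b) with (a + b).
  rewrite Cmod_mult, Cmod_pow. destruct n as [|n].
  - rewrite HA0, Cmod_1. simpl. lra.
  - simpl Nat.eqb. cbv iota. rewrite Rplus_0_l, <- Rmult_assoc.
    apply Rmult_le_compat_r; [now apply pow_le|].
    assert (H := caratheodory_coef_bound d u n Hd Hu).
    assert (Hden := coef_den_ge_1 alpha n ltac:(lra)).
    rewrite HdA, Cmod_mult, Cmod_R, Rabs_pos_eq, Hd0 in H by lra.
    unfold growth_coef. apply Rmult_le_reg_l with (coef_den alpha (S (S n))); [lra|].
    eapply Rle_trans; [exact H|]. right. field. lra.
Qed.

Lemma growth_bounds (alpha M : R) (A : nat -> C) (F p : C -> C) :
  0 < alpha <= 1 -> A 0%nat = RtoC 0 -> A 1%nat = RtoC 1 ->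
  (forall w, in_disk w -> is_Cpseries A w (F w)) ->
  (forall w, in_disk w ->
     is_Cpseries (fun n => RtoC (coef_den alpha (S n)) * A (S n))%C w (p w)) ->
  (forall w, in_disk w -> - M < Re (p w)) ->
  forall z, in_disk z ->
  lower_bound alpha M (Cmod z) <= Cmod (F z) <= upper_bound alpha M (Cmod z).
Proof.
  intros Ha HA0 HA1 HF Hp HM z Hz.
  (* These are the coefficients of [p + M], whose real part is positive; the constant one is
     [1 - alpha + M]. *)
  set (d := fun n => (RtoC (coef_den alpha (S n)) * A (S n) + const_coef (RtoC M) n)%C).
  assert (Hd : forall w, in_disk w -> is_Cpseries d w (p w + RtoC M)%C).
  { intros w Hw.
    generalize (is_Cseries_plus _ _ _ _ (Hp w Hw) (is_Cpseries_const (RtoC M) w)).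
    apply is_Cseries_ext; trivial. intros n. unfold d. ring. }
  assert (Hu : forall w, in_disk w -> 0 <= Re (p w + RtoC M)%C).
  { intros w Hw. specialize (HM w Hw). unfold Re in *. simpl. lra. }
  assert (Hd0 : Re (d 0%nat) = M - alpha + 1).
  { unfold d. rewrite HA1. unfold coef_den, Re. simpl. ring. }
  assert (HdA : forall n, d (S n) = (RtoC (coef_den alpha (S (S n))) * A (S (S n)))%C).
  { intros n. unfold d, const_coef. ring. }
  assert (Hr := Cmod_ge_0 z). assert (Hz' := Hz). unfold in_disk in Hz'.
  rewrite lower_bound_PSeries, upper_bound_PSeries by (trivial; lra).
  destruct (Ceq_dec z (RtoC 0)) as [E|E].
  - assert (HF0 := HF z Hz). rewrite E in HF0 at 1. apply is_Cpseries_at_0 in HF0.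
    rewrite HF0, HA0, E, Cmod_0, !Rmult_0_l. lra.
  - assert (Hphi : is_Cpseries (fun n => A (S n)) z (F z / z)%C).
    { generalize (is_Cseries_scal (/ z)%C _ _ (is_Cseries_incr _ _ (HF z Hz))).
      apply is_Cseries_ext.
      - intros n. simpl. field. trivial.
      - rewrite HA0. simpl. field. trivial. }
    assert (EF : Cmod (F z) = Cmod z * Cmod (F z / z)%C).
    { rewrite <- Cmod_mult. f_equal. field. trivial. }
    rewrite EF. split; apply Rmult_le_compat_l; trivial.
    (* The lower bound holds already for the real part of [F z / z]. *)
    + eapply Rle_trans; [|eapply Rle_trans; [apply Rle_abs|apply re_le_Cmod]].
      now apply (Re_quotient_ge alpha _ (fun n => A (S n)) d (fun w => p w + RtoC M)%C z).
    + now apply (Cmod_quotient_le alpha _ (fun n => A (S n)) d (fun w => p w + RtoC M)%C z).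
Qed.

(** * The extremal map *)

(** Completes a series starting at the second power to a full coefficient sequence; [a 0] and [a 1]
    are replaced by the prescribed heads. *)
Definition shift_coef (a0 a1 : C) (a : nat -> C) (n : nat) : C :=
  match n with O => a0 | S O => a1 | S (S k) => a (k + 2)%nat end.

Lemma is_Cpseries_shift_coef (a0 a1 : C) (a : nat -> C) (z l : C) :
  is_Cseries (fun k => a (k + 2)%nat * z ^ (k + 2))%C l ->
  is_Cpseries (shift_coef a0 a1 a) z (l + a1 * z + a0)%C.
Proof.
  intros H.
  assert (H1 : is_Cseries (fun k => shift_coef a0 a1 a (S (S k)) * z ^ S (S k))%C l).
  { revert H. apply is_Cseries_ext; trivial. intros k.
    simpl shift_coef. now replace (S (S k)) with (k + 2)%nat by lia. }
  apply (is_Cseries_decr (fun k => shift_coef a0 a1 a (S k) * z ^ S k)%C) in H1.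
  apply (is_Cseries_decr (fun k => shift_coef a0 a1 a k * z ^ k)%C) in H1.
  revert H1. apply is_Cseries_ext; trivial. simpl. ring.
Qed.

Definition extremal_coef (alpha M : R) : nat -> C :=
  shift_coef (RtoC 0) (RtoC 1)
    (fun n => RtoC (2 * (M - alpha + 1)) * RtoC (/ coef_den alpha n))%C.

Lemma Cpow_div_RtoC (z : C) (n : nat) (e : R) :
  e <> 0 -> (z ^ n / RtoC e = RtoC (/ e) * z ^ n)%C.
Proof. intros He. rewrite RtoC_inv by easy. apply Cmult_comm. Qed.

Lemma ex_Cseries_extremal (alpha : R) (z : C) : 0 < alpha -> in_disk z ->
  exists l, is_Cseries (fun k => z ^ (k + 2) / RtoC (coef_den alpha (k + 2)))%C l.
Proof.
  intros Ha Hz. apply ex_Cseries_Cmod. assert (Hr := Cmod_ge_0 z).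
  eexists. apply is_series_ext with
    (2 := is_series_pow_div_coef_den alpha (Cmod z) Ha
            ltac:(rewrite Rabs_pos_eq by easy; exact Hz)).
  intros k. eq_as R. replace (k + 2)%nat with (S (S k)) by lia.
  assert (H := coef_den_ge_1 alpha k Ha).
  rewrite Cmod_div, Cmod_pow, Cmod_R, Rabs_pos_eq; trivial; [lra|].
  intros E. injection E. lra.
Qed.

Lemma extremal_map_Cpseries (alpha M : R) (z : C) : 0 < alpha -> in_disk z ->
  is_Cpseries (extremal_coef alpha M) z (extremal_map alpha M z).
Proof.
  intros Ha Hz. destruct (ex_Cseries_extremal alpha z Ha Hz) as [l Hl].
  unfold extremal_map. rewrite (C_Series_unique _ l Hl).
  replace (z + RtoC (2 * (M - alpha + 1)) * l)%C
    with (RtoC (2 * (M - alpha + 1)) * l + RtoC 1 * z + RtoC 0)%C by ring.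
  apply is_Cpseries_shift_coef.
  generalize (is_Cseries_scal (RtoC (2 * (M - alpha + 1))) _ _ Hl).
  apply is_Cseries_ext; trivial. intros k.
  replace (k + 2)%nat with (S (S k)) by lia.
  assert (H := coef_den_ge_1 alpha k Ha).
  rewrite Cpow_div_RtoC by lra. ring.
Qed.

(** * Rotations of the extremal map and their membership in the class *)

Definition rotation_coef (theta : R) (c : nat -> C) (n : nat) : C :=
  (cis (- theta) * c n * cis theta ^ n)%C.

Lemma in_disk_cis_mult (theta : R) (z : C) : in_disk z -> in_disk (cis theta * z)%C.
Proof. unfold in_disk. now rewrite Cmod_mult, Cmod_cis, Rmult_1_l. Qed.

Lemma rotation_Cpseries (theta : R) (c : nat -> C) (f : C -> C) :
  (forall w, in_disk w -> is_Cpseries c w (f w)) -> forall z, in_disk z ->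
  is_Cpseries (rotation_coef theta c) z (rotation theta f z).
Proof.
  intros Hf z Hz.
  generalize (is_Cseries_scal (cis (- theta)) _ _ (Hf _ (in_disk_cis_mult theta z Hz))).
  apply is_Cseries_ext; trivial. intros n. unfold rotation_coef. rewrite Cpow_mult_l. ring.
Qed.

Lemma cis_opp_mult (theta : R) : (cis (- theta) * cis theta = 1)%C.
Proof. rewrite <- cis_plus, Rplus_opp_l. apply cis_0. Qed.

(** Equivalently, [2 v - 1 = (1 + w) / (1 - w)] has positive real part. *)
Lemma one_lt_double_Re_geometric (v w : C) : in_disk w -> (v * (1 - w) = 1)%C -> 1 < 2 * Re v.
Proof.
  intros Hw Hv. assert (H := Re_geometric_ge w v Hw Hv). unfold in_disk in Hw.
  assert (H0 := Cmod_ge_0 w).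
  assert (/ 2 < / (1 + Cmod w)); [|lra].
  apply Rinv_lt_contravar; lra.
Qed.

(** The operator cancels the denominators [coef_den], so with [m = M - alpha + 1] and
    [w = cis theta * z] it gives [m (1 + w) / (1 - w) - M]. *)
Lemma extremal_rotation_operator (alpha M theta : R) (z : C) :
  0 < M -> 0 < alpha <= 1 -> in_disk z ->
  - M < Re (alpha_operator alpha (rotation theta (extremal_map alpha M)) z).
Proof.
  intros HM Ha Hz.
  assert (HE := rotation_Cpseries theta _ _
                  (fun w Hw => extremal_map_Cpseries alpha M w ltac:(lra) Hw)).
  assert (Hop := alpha_operator_Cpseries alpha _ _ HE z Hz).
  assert (Hw := in_disk_cis_mult theta z Hz). set (w := (cis theta * z)%C) in *.
  destruct (geometric_Cpseries w Hw) as [v [Hv Ev]].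
  set (m := M - alpha + 1).
  (* A geometric series with ratio [w] and factor [2 m], its constant term corrected from [2 m] to
     [1 - alpha]. *)
  assert (Hop' : is_Cseries (fun n => RtoC (2 * m) * (RtoC 1 * w ^ n)
                                      + const_coef (RtoC (1 - alpha - 2 * m)) n * z ^ n)%C
                   (RtoC (2 * m) * v + RtoC (1 - alpha - 2 * m))%C).
  { apply is_Cseries_plus; [now apply is_Cseries_scal|apply is_Cpseries_const]. }
  assert (E : (alpha_operator alpha (rotation theta (extremal_map alpha M)) z
               = RtoC (2 * m) * v + RtoC (1 - alpha - 2 * m))%C).
  { refine (is_Cseries_unique _ _ _ Hop _). revert Hop'. apply is_Cseries_ext; trivial.
    intros [|n]; unfold rotation_coef, extremal_coef, shift_coef, const_coef.
    - replace (coef_den alpha 1) with (1 - alpha) by (unfold coef_den; simpl; ring).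
      replace (cis (- theta) * RtoC 1 * cis theta ^ 1)%C with (RtoC 1)
        by (transitivity (cis (- theta) * cis theta)%C;
            [symmetry; apply cis_opp_mult | simpl; ring]).
      simpl Cpow. rewrite RtoC_minus. ring.
    - replace (n + 2)%nat with (S (S n)) by lia. fold m.
      assert (H := coef_den_ge_1 alpha n ltac:(lra)).
      set (e := coef_den alpha (S (S n))) in *.
      replace (RtoC e * (cis (- theta) * (RtoC (2 * m) * RtoC (/ e)) * cis theta ^ S (S n)))%C
        with (RtoC (2 * m) * (RtoC e * RtoC (/ e)) * (cis (- theta) * cis theta)
              * cis theta ^ S n)%C by (simpl Cpow; ring).
      rewrite cis_opp_mult, <- RtoC_mult, Rinv_r by lra.
      unfold w. rewrite Cpow_mult_l. ring. }
  rewrite E.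
  replace (Re (RtoC (2 * m) * v + RtoC (1 - alpha - 2 * m))%C)
    with (m * (2 * Re v - 1) - M) by (unfold m, Re; simpl; ring).
  assert (H := one_lt_double_Re_geometric v w Hw Ev).
  assert (0 < m * (2 * Re v - 1)) by (apply Rmult_lt_0_compat; unfold m; lra).
  lra.
Qed.

Lemma analytic_on_disk_Cpseries (c : nat -> C) (f : C -> C) :
  (forall w, in_disk w -> is_Cpseries c w (f w)) -> analytic_on_disk f.
Proof.
  intros Hf z Hz. exists (C_derive f z). apply (C_derive_Cpseries c f Hf z Hz).
Qed.

Lemma in_disk_0 : in_disk (RtoC 0).
Proof. unfold in_disk. rewrite Cmod_0. lra. Qed.

Lemma Cpseries_at_0 (c : nat -> C) (f : C -> C) :
  (forall w, in_disk w -> is_Cpseries c w (f w)) ->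
  f (RtoC 0) = c 0%nat /\ C_derive f (RtoC 0) = c 1%nat.
Proof.
  intros Hf. split.
  - apply is_Cpseries_at_0, Hf, in_disk_0.
  - rewrite (is_Cpseries_at_0 _ _ (proj2 (C_derive_Cpseries c f Hf _ in_disk_0))).
    unfold Cderive_coef. simpl. ring.
Qed.

Lemma zero_Cpseries (z : C) : is_Cpseries (fun _ => RtoC 0) z (RtoC 0).
Proof.
  generalize (is_Cpseries_const (RtoC 0) z). apply is_Cseries_ext; trivial.
  intros [|n]; reflexivity.
Qed.

Lemma extremal_rotation_class_P0H (alpha M theta : R) : 0 < M -> 0 < alpha <= 1 ->
  class_P0H alpha M (rotation theta (extremal_map alpha M)) (fun _ : C => RtoC 0).
Proof.
  intros HM Ha.
  assert (HE := rotation_Cpseries theta _ _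
                  (fun w Hw => extremal_map_Cpseries alpha M w ltac:(lra) Hw)).
  assert (HZ : forall w, in_disk w -> is_Cpseries (fun _ => RtoC 0) w (RtoC 0))
    by (intros; apply zero_Cpseries).
  destruct (Cpseries_at_0 _ _ HE) as [E0 E1].
  destruct (Cpseries_at_0 _ _ HZ) as [_ Z1].
  split; [|split; [exact Z1|]].
  - split; [now apply analytic_on_disk_Cpseries with (1 := HE)|].
    split; [now apply analytic_on_disk_Cpseries with (1 := HZ)|].
    split; [|split; [|easy]].
    + rewrite E0. unfold rotation_coef, extremal_coef. simpl. ring.
    + rewrite E1, <- (cis_opp_mult theta). unfold rotation_coef, extremal_coef. simpl. ring.
  - intros z Hz.
    assert (Hg : alpha_operator alpha (fun _ => RtoC 0) z = RtoC 0).
    { refine (is_Cseries_unique _ _ _ (alpha_operator_Cpseries alpha _ _ HZ z Hz) _).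
      generalize (zero_Cpseries z). apply is_Cseries_ext; trivial. intros n. ring. }
    rewrite Hg, Cmod_0, Rplus_0_r. now apply extremal_rotation_operator.
Qed.

(** For [x = r >= 0] the value is the upper bound, and for [x = - r] it is the negative of the lower
    bound. *)
Lemma extremal_map_real (alpha M x : R) : 0 < alpha -> Rabs x < 1 ->
  extremal_map alpha M (RtoC x)
  = RtoC (x * (1 + 2 * (M - alpha + 1) * PSeries (growth_coef alpha) x)).
Proof.
  intros Ha Hx. unfold extremal_map.
  rewrite (C_Series_unique _ (RtoC (x * PSeries (growth_coef alpha) x))).
  - rewrite <- RtoC_mult, <- RtoC_plus. f_equal. ring.
  - assert (E : forall k, (RtoC x ^ (k + 2) / RtoC (coef_den alpha (k + 2)))%C
                          = RtoC (x ^ (k + 2) / coef_den alpha (k + 2))).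
    { intros k. replace (k + 2)%nat with (S (S k)) by lia.
      assert (H := coef_den_ge_1 alpha k Ha). rewrite RtoC_div, RtoC_pow by lra. reflexivity. }
    apply is_Cseries_pair.
    + generalize (is_series_pow_div_coef_den alpha x Ha Hx). apply is_series_ext.
      intros k. rewrite E. reflexivity.
    + generalize (is_series_delta 0 0). apply is_series_ext.
      intros k. rewrite E. now destruct (k =? 0)%nat.
Qed.

Lemma Cmod_rotation (theta : R) (f : C -> C) (z : C) :
  Cmod (rotation theta f z) = Cmod (f (cis theta * z)%C).
Proof. unfold rotation. now rewrite Cmod_mult, Cmod_cis, Rmult_1_l. Qed.

Theorem theorem2p4 (M alpha : R) (hM : 0 < M) (halpha : 0 < alpha <= 1)
    (h g : C -> C) (a b : nat -> C)
    (hf : class_P0H alpha M h g)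
    (hh : forall z : C, in_disk z ->
       is_series (K := C_AbsRing) (V := C_NormedModule)
         (fun k : nat => (a (k + 2)%nat * z ^ (k + 2))%C) (h z - z)%C)
    (hg : forall z : C, in_disk z ->
       is_series (K := C_AbsRing) (V := C_NormedModule)
         (fun k : nat => (b (k + 2)%nat * z ^ (k + 2))%C) (g z)) :
  (forall z : C, in_disk z ->
     lower_bound alpha M (Cmod z) <= Cmod (harmonic_map h g z)
       <= upper_bound alpha M (Cmod z)) /\
  (forall theta : R,
     class_P0H alpha M (rotation theta (extremal_map alpha M))
                       (fun _ : C => RtoC 0)) /\
  (forall z : C, in_disk z -> z <> RtoC 0 ->
     (exists theta : R,
        Cmod (rotation theta (extremal_map alpha M) z)
          = upper_bound alpha M (Cmod z)) /\
     (0 <= lower_bound alpha M (Cmod z) ->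
      exists theta : R,
        Cmod (rotation theta (extremal_map alpha M) z)
          = lower_bound alpha M (Cmod z))).
Proof.
  split; [|split; [intros theta; now apply extremal_rotation_class_P0H|]].
  - intros z Hz.
    set (ca := shift_coef (RtoC 0) (RtoC 1) a). set (cb := shift_coef (RtoC 0) (RtoC 0) b).
    assert (Hh : forall w, in_disk w -> is_Cpseries ca w (h w)).
    { intros w Hw. generalize (is_Cpseries_shift_coef (RtoC 0) (RtoC 1) _ _ _ (hh w Hw)).
      apply is_Cseries_ext; trivial. ring. }
    assert (Hg : forall w, in_disk w -> is_Cpseries cb w (g w)).
    { intros w Hw. generalize (is_Cpseries_shift_coef (RtoC 0) (RtoC 0) _ _ _ (hg w Hw)).
      apply is_Cseries_ext; trivial. ring. }
    (* [eps] depends on [z] but is then held constant, so [h + eps g] is analytic on the whole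
       disk. *)
    assert (Heps : exists eps, Cmod eps = 1 /\ Cconj (g z) = (eps * g z)%C).
    { destruct (Ceq_dec (g z) (RtoC 0)) as [E|E].
      - exists (RtoC 1). split; [apply Cmod_1|]. rewrite E.
        apply injective_projections; simpl; ring.
      - exists (Cconj (g z) / g z)%C. split; [|now field].
        rewrite Cmod_div, Cmod_conj by trivial. field.
        apply Rgt_not_eq. now apply Cmod_gt_0. }
    destruct Heps as [eps [He1 He2]]. unfold harmonic_map. rewrite He2.
    apply (growth_bounds alpha M (fun n => ca n + eps * cb n)%C (fun w => h w + eps * g w)%C
             (fun w => alpha_operator alpha h w + eps * alpha_operator alpha g w)%C); trivial.
    + simpl. ring.
    + simpl. ring.
    + intros w Hw.
      generalize (is_Cseries_plus _ _ _ _ (Hh w Hw) (is_Cseries_scal eps _ _ (Hg w Hw))).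
      apply is_Cseries_ext; trivial. intros n. ring.
    + intros w Hw.
      generalize (is_Cseries_plus _ _ _ _ (alpha_operator_Cpseries alpha _ _ Hh w Hw)
                    (is_Cseries_scal eps _ _ (alpha_operator_Cpseries alpha _ _ Hg w Hw))).
      apply is_Cseries_ext; trivial. intros n. ring.
    (* Adding [eps] times the operator of [g] lowers the real part by at most its modulus, which the
       class inequality absorbs. *)
    + intros w Hw. destruct hf as [_ [_ Hf]]. specialize (Hf w Hw).
      assert (H := re_le_Cmod (eps * alpha_operator alpha g w)).
      rewrite Cmod_mult, He1, Rmult_1_l in H.
      assert (H1 := Rabs_maj2 (Re (eps * alpha_operator alpha g w)%C)).
      change (- M < Re (alpha_operator alpha h w) + Re (eps * alpha_operator alpha g w)%C). lra.
  - intros z Hz _. destruct (polar_form z) as [t Ht].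
    assert (Hr := Cmod_ge_0 z). unfold in_disk in Hz. set (r := Cmod z) in *.
    rewrite lower_bound_PSeries, upper_bound_PSeries by lra.
    assert (Hm : 0 < M - alpha + 1) by lra. split.
    (* The angle [- t] brings [z] to the positive real point [r]. *)
    + exists (- t).
      replace (Cmod (rotation (- t) (extremal_map alpha M) z))
        with (Cmod (extremal_map alpha M (RtoC r))).
      2:{ rewrite Cmod_rotation. do 2 f_equal. rewrite Ht.
          replace (cis (- t) * (RtoC r * cis t))%C with (RtoC r * (cis (- t) * cis t))%C by ring.
          rewrite cis_opp_mult. ring. }
      rewrite extremal_map_real, Cmod_R by (trivial; rewrite ?Rabs_pos_eq; lra).
      apply Rabs_pos_eq. apply Rmult_le_pos; trivial.
      assert (0 <= PSeries (growth_coef alpha) r); [|nra].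
      replace 0 with (Series (fun _ => 0)).
      * apply Series_le.
        -- intros n. split; [lra|].
           apply Rmult_le_pos; [apply growth_coef_bound; lra|now apply pow_le].
        -- destruct (ex_pseries_growth_coef alpha r) as [l Hl]; [lra|rewrite Rabs_pos_eq; lra|].
           exists l. now apply is_pseries_R.
      * apply is_series_unique. generalize (is_series_delta 0 0). apply is_series_ext.
        intros n. now destruct (n =? 0)%nat.
    (* The extra half turn brings [z] to [- r]; the value there is minus the lower bound, and [HL]
       turns its modulus into the bound itself. *)
    + intros HL. exists (- t + PI).
      replace (Cmod (rotation (- t + PI) (extremal_map alpha M) z))
        with (Cmod (extremal_map alpha M (RtoC (- r)))).
      2:{ rewrite Cmod_rotation. do 2 f_equal. rewrite Ht, cis_plus.
          replace (cis (- t) * cis PI * (RtoC r * cis t))%C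
            with (RtoC r * cis PI * (cis (- t) * cis t))%C by ring.
          rewrite cis_opp_mult. unfold cis. rewrite cos_PI, sin_PI.
          apply injective_projections; simpl; ring. }
      rewrite extremal_map_real, Cmod_R by (trivial; rewrite ?Rabs_Ropp, ?Rabs_pos_eq; lra).
      rewrite <- Ropp_mult_distr_l, Rabs_Ropp. now apply Rabs_pos_eq.
Qed.
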